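(* Let $\mathcal H=(\mathcal V,\mathcal E)$ be a (finite) tree-like higraph, i.e. $|t(\varepsilon)|=1$ for every edge $\varepsilon$, and let $\widetilde{\mathcal A}$ be the path DGA of its bigraph with differential $\tilde\delta$. Let $\tilde D=\sum\tilde\rho$, the sum over all good paths $\tilde\rho$ of weight $1$. Then $\tilde\delta\tilde D=\tilde D\,\tilde D$ (product in $\widetilde{\mathcal A}$).
   Context: $\mathbb F=\{0,1\}$. A directed hypergraph $\mathcal H=(\mathcal V,\mathcal E)$ has edges $\varepsilon=(I,J)\in2^{\mathcal V}\times2^{\mathcal V}$ with source $I$, target $J$. It is a higraph if for all edges $\varepsilon,\varepsilon'$: (Transitive) if $t(\varepsilon)\cap s(\varepsilon')\ne\emptyset$ then it equals $\{K\}$ for one vertex $K$, the unions $s(\varepsilon)\cup(s(\varepsilon')\setminus\{K\})$ and $(t(\varepsilon)\setminus\{K\})\cup t(\varepsilon')$ are disjoint unions and their pair is an edge; (Acyclic) if $t(\varepsilon)\cap s(\varepsilon')$ and $t(\varepsilon')\cap s(\varepsilon)$ are both non-empty then $\varepsilon=\varepsilon'=(\{K\},\{K\})$. $\mathcal V$ is finite. Bigraph: vertices $\mathcal V\times\{o,u,s\}$, projection $\eta$ to $\mathcal V$; a vertex $(K,X)$ has type $X$ (interior $o$, unstable $u$, stable $s$). Edges: triples $(\mu,\tilde I,\tilde J)$, $\mu\in\mathbb F$, $\eta$ injective on $\tilde I$ and on $\tilde J$, $(\eta\tilde I,\eta\tilde J)\in\mathcal E$, and if $\mu=0$ then $\tilde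 I$ has no stable and $\tilde J$ no unstable vertex, if $\mu=1$ then $\tilde I\cup\tilde J$ has no interior vertex; source $\tilde I$, target $\tilde J$; interior if $\mu=0$, boundary if $\mu=1$. Weight: $1$ for interior edges, $2-(\#\text{stable in }\tilde I)-(\#\text{unstable in }\tilde J)$ for boundary edges. A path is a non-empty finite directed tree $T=(V,E)$ (nodes, arrows) with a labeling $\tilde\rho:V\to$ bigraph edges such that for each arrow $e$, $t(\tilde\rho(s(e)))\cap s(\tilde\rho(t(e)))$ is a single vertex $\tilde\rho(e)$, and distinct arrows with a common source node or common target node have distinct $\tilde\rho(e)$; label-compatible tree isomorphisms identify paths. Source $s(\tilde\rho)=\bigcup_v(s(\tilde\rho(v))\setminus\{\tilde\rho(e):t(e)=v\})$, target $t(\tilde\rho)=\bigcup_v(t(\tilde\rho(v))\setminus\{\tilde\rho(e):s(e)=v\})$; a vertex of $s(\tilde\rho)$ in $s(\tilde\rho(v))$ is sourced by $v$, a vertex of $t(\tilde\rho)$ in $t(\tilde\rho(v))$ targeted by $v$. Weight of a path = sum of edge weights; length = number of nodes; boundary path = all edges boundary. A path is good if every vertex of $s(\tilde\rho)\cup t(\tilde\rho)$ is of type $o$ or $u$. Refinement $r((\tilde\rho,v),\tilde\rho'')$ for a node $v$ and a path $\tilde\rho''$ with the same source and target as the edge $\tilde\rho(v)$: replace $v$ by the tree of $\tilde\rho''$, each arrow $(a,v)$ by $(a,v'')$ with $v''$ sourcing $\tilde\rho((a,v))$ in $\tilde\rho''$, each $(v,b)$ by $(v'',b)$ with $v''$ targeting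 $\tilde\rho((v,b))$; it is $0$ otherwise. Path DGA $\widetilde{\mathcal A}$: $\mathbb F$-vector space on the set of paths, graded by weight. Product: if $t(\tilde\rho_1)\cap s(\tilde\rho_2)=\{K\}$, with $K$ targeted by node $v_1$ of $\tilde\rho_1$ and sourced by node $v_2$ of $\tilde\rho_2$, then $\tilde\rho_1\tilde\rho_2$ is the path on the disjoint union of the two trees plus the arrow $(v_1,v_2)$, with the combined labels; if the intersection is empty the product is $0$; extended bilinearly (for tree-like higraphs the intersection has at most one element). Differential: $\tilde\delta\tilde\rho=\sum_{v\text{ interior}}\sum_{\tilde\rho'}r((\tilde\rho,v),\tilde\rho')+\sum_{v\text{ boundary}}\sum_{\bar\rho'}r((\tilde\rho,v),\bar\rho')$, where $\tilde\rho'$ ranges over paths of weight $2$ and $\bar\rho'$ over boundary paths of length $2$, extended linearly. *)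

(* Defs.v *)
From HB Require Import structures.
From mathcomp Require Import all_boot all_order all_algebra.
Set Implicit Arguments. Unset Strict Implicit. Unset Printing Implicit Defensive.
Import GRing.Theory Num.Theory.

(* ---------- vertex types of the bigraph: interior o, unstable u, stable s *)
Inductive vtype := TO | TU | TS.
Definition vt2o (x : vtype) : 'I_3 :=
  match x with TO => inord 0 | TU => inord 1 | TS => inord 2 end.
Definition o2vt (i : 'I_3) : vtype :=
  match val i with 0 => TO | 1 => TU | _ => TS end.
Lemma vtK : cancel vt2o o2vt. Proof. by case; rewrite /o2vt /= inordK. Qed.
HB.instance Definition _ := Finite.copy vtype (can_type vtK).

Section Higraph.
Variable V : finType.

Notation hedge := ({set V} * {set V})%type.
Definition hs (e : hedge) := e.1.
Definition ht (e : hedge) := e.2.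

Definition higraph_transitive (E : {set hedge}) : Prop :=
  forall e e', e \in E -> e' \in E -> ht e :&: hs e' != set0 ->
  exists K, [/\ ht e :&: hs e' = [set K],
    [disjoint hs e & hs e' :\ K], [disjoint ht e :\ K & ht e']
    & (hs e :|: (hs e' :\ K), (ht e :\ K) :|: ht e') \in E].

Definition higraph_acyclic (E : {set hedge}) : Prop :=
  forall e e', e \in E -> e' \in E ->
  ht e :&: hs e' != set0 -> ht e' :&: hs e != set0 ->
  e = e' /\ exists K, e = ([set K], [set K]).

Definition higraph (E : {set hedge}) : Prop :=
  higraph_transitive E /\ higraph_acyclic E.

Definition tree_like (E : {set hedge}) : Prop :=
  forall e, e \in E -> #|ht e| = 1%N.

Definition bvert := (V * vtype)%type.
(* bigraph edge (mu, I~, J~); mu = false : interior (0), mu = true : boundary (1) *)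
Definition bedge := (bool * {set bvert} * {set bvert})%type.
Definition bmu (b : bedge) := b.1.1.
Definition bs (b : bedge) := b.1.2.
Definition bt (b : bedge) := b.2.

Definition bedge_valid (E : {set hedge}) (b : bedge) : bool :=
  [&& [forall x in bs b, forall y in bs b, (x.1 == y.1) ==> (x == y)]
      && [forall x in bt b, forall y in bt b, (x.1 == y.1) ==> (x == y)],
      ((fst @: bs b), (fst @: bt b)) \in E &
      if bmu b then [forall x in bs b :|: bt b, x.2 != TO]
      else [forall x in bs b, x.2 != TS] && [forall x in bt b, x.2 != TU]].

Open Scope ring_scope.
Definition bweight (b : bedge) : int :=
  if bmu b then
    2%:Z - (#|[set x in bs b | x.2 == TS]|)%:Z - (#|[set x in bt b | x.2 == TU]|)%:Z
  else 1.
Close Scope ring_scope.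

(* ---------- paths: a finite set of nodes N, node labels, and arrows.
   The label of an arrow (a,b) is the vertex t(lab a) \cap s(lab b)
   (required to be a singleton), so it is determined by the node labels. *)
Record pth (N : finType) := Pth { plab : N -> bedge; parr : rel N }.

Section PathDefs.
Variable N : finType.
Variable P : pth N.

Definition alab (a b : N) : {set bvert} := bt (plab P a) :&: bs (plab P b).
Definition inlab (v : N) : {set bvert} := \bigcup_(a | parr P a v) alab a v.
Definition outlab (v : N) : {set bvert} := \bigcup_(b | parr P v b) alab v b.

Definition psrc : {set bvert} := \bigcup_(v : N) (bs (plab P v) :\: inlab v).
Definition ptgt : {set bvert} := \bigcup_(v : N) (bt (plab P v) :\: outlab v).
Definition sourced (x : bvert) (v : N) : bool := x \in bs (plab P v) :\: inlab v.
Definition targeted (x : bvert) (v : N) : bool := x \in bt (plab P v) :\: outlab v.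

Definition is_dtree : bool :=
  [&& 0 < #|N|, [forall a, ~~ parr P a a],
      [forall a, forall b, ~~ (parr P a b && parr P b a)],
      #|[set p : N * N | parr P p.1 p.2]| == #|N| - 1 &
      [forall a, forall b, connect (fun x y => parr P x y || parr P y x) a b]].

Definition is_path (E : {set hedge}) : bool :=
  [&& is_dtree,
      [forall v, bedge_valid E (plab P v)],
      [forall a, forall b, parr P a b ==> (#|alab a b| == 1)],
      [forall a, forall b, forall b',
         [&& parr P a b, parr P a b' & b != b'] ==> (alab a b != alab a b')] &
      [forall a, forall a', forall b,
         [&& parr P a b, parr P a' b & a != a'] ==> (alab a b != alab a' b)]].

Definition pweight : int := (\sum_(v : N) bweight (plab P v))%R.
Definition pboundary : bool := [forall v, bmu (plab P v)].
Definition pgood : bool := [forall x in psrc :|: ptgt, x.2 != TS].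
End PathDefs.

Definition plength (N : finType) (P : pth N) : nat := #|N|.

Definition piso (N1 N2 : finType) (P1 : pth N1) (P2 : pth N2) : bool :=
  [exists f : {ffun N1 -> N2},
    [&& injectiveb f, #|N1| == #|N2|,
        [forall x, plab P2 (f x) == plab P1 x] &
        [forall x, forall y, parr P2 (f x) (f y) == parr P1 x y]]].

Definition rnode (N : finType) (v : N) (N2 : finType) := ({x : N | x != v} + N2)%type.

Definition refine_arr (N N2 : finType) (P : pth N) (v : N) (P2 : pth N2)
  (x y : rnode v N2) : bool :=
  match x, y with
  | inl a, inl b => parr P (val a) (val b)
  | inr a, inr b => parr P2 a b
  | inl a, inr b =>
      parr P (val a) v && [exists z, (z \in alab P (val a) v) && sourced P2 z b]
  | inr a, inl b =>
      parr P v (val b) && [exists z, (z \in alab P v (val b)) && targeted P2 z a]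
  end.

Definition refine_lab (N N2 : finType) (P : pth N) (v : N) (P2 : pth N2)
  (x : rnode v N2) : bedge :=
  match x with inl a => plab P (val a) | inr a => plab P2 a end.
Arguments refine_arr [N N2] P v P2 x y.
Arguments refine_lab [N N2] P v P2 x.

Definition refine (N N2 : finType) (P : pth N) (v : N) (P2 : pth N2)
  : pth (rnode v N2) := Pth (refine_lab P v P2) (refine_arr P v P2).
Arguments refine [N N2] P v P2.

(* refinement is non-zero only if rho'' has the source and target of rho(v) *)
Definition refinable (N N2 : finType) (P : pth N) (v : N) (P2 : pth N2) : bool :=
  (psrc P2 == bs (plab P v)) && (ptgt P2 == bt (plab P v)).
Arguments refinable [N N2] P v P2.

(* ---------- product rho1 rho2 (non-zero iff t(rho1) \cap s(rho2) = {K}) *)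
Definition mul_arr (N1 N2 : finType) (P1 : pth N1) (P2 : pth N2)
  (x y : (N1 + N2)%type) : bool :=
  match x, y with
  | inl a, inl b => parr P1 a b
  | inr a, inr b => parr P2 a b
  | inl a, inr b => [exists K, (K \in ptgt P1 :&: psrc P2)
                               && targeted P1 K a && sourced P2 K b]
  | inr _, inl _ => false
  end.

Definition mul_lab (N1 N2 : finType) (P1 : pth N1) (P2 : pth N2)
  (x : (N1 + N2)%type) : bedge :=
  match x with inl a => plab P1 a | inr b => plab P2 b end.

Definition pmul (N1 N2 : finType) (P1 : pth N1) (P2 : pth N2) : pth (N1 + N2)%type :=
  Pth (mul_lab P1 P2) (mul_arr P1 P2).

Definition mulable (N1 N2 : finType) (P1 : pth N1) (P2 : pth N2) : bool :=
  #|ptgt P1 :&: psrc P2| == 1%N.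

(* ---------- concrete representatives of isomorphism classes: paths on 'I_k *)
Definition CP (k : nat) := ({ffun 'I_k -> bedge} * {ffun 'I_k * 'I_k -> bool})%type.
Definition cp2p (k : nat) (c : CP k) : pth 'I_k :=
  Pth (fun i => c.1 i) (fun i j => c.2 (i, j)).

Definition canon (k : nat) (c : CP k) : bool :=
  [forall d : CP k, piso (cp2p c) (cp2p d) ==> (enum_rank c <= enum_rank d)%N].

Definition basis (E : {set hedge}) (k : nat) (c : CP k) : bool :=
  canon c && is_path (cp2p c) E.

Definition inD (E : {set hedge}) (k : nat) (c : CP k) : bool :=
  [&& basis E c, pgood (cp2p c) & pweight (cp2p c) == 1%R].

(* coefficient (in F_2) of the class of rho in  delta~ D~ :
   triples (rho0 in D~, node v of rho0, rho') with r((rho0,v),rho') = [rho],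
   rho' of weight 2 if v is interior, rho' a boundary path of length 2 if
   v is boundary. *)
Definition coef_dD (E : {set hedge}) (n : nat) (rho : CP n) : bool :=
  odd (\sum_(k < n.+1) \sum_(k' < n.+1)
    #|[set x : CP k * 'I_k * CP k' |
        let: (c0, v, c') := x in
        [&& inD E c0, basis E c',
            (if bmu (plab (cp2p c0) v)
             then pboundary (cp2p c') && (plength (cp2p c') == 2%N)
             else pweight (cp2p c') == 2%R),
            refinable (cp2p c0) v (cp2p c') &
            piso (refine (cp2p c0) v (cp2p c')) (cp2p rho)]]|).

Definition coef_DD (E : {set hedge}) (n : nat) (rho : CP n) : bool :=
  odd (\sum_(k < n.+1) \sum_(k' < n.+1)
    #|[set x : CP k * CP k' |
        [&& inD E x.1, inD E x.2, mulable (cp2p x.1) (cp2p x.2) &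
            piso (pmul (cp2p x.1) (cp2p x.2)) (cp2p rho)]]|).

End Higraph.

(* Main.v *)
(* A path of a tree-like higraph is a tree whose arrows point to the root, and
   it has no automorphism, since the arrows into a node have distinct labels.
   Hence the coefficient of a path P in D D counts the arrows cutting P into
   two good paths of weight 1, and its coefficient in delta D counts the
   subtrees of P that can be contracted to an interior edge (weight 2) or to a
   boundary edge (two boundary nodes) leaving a good path of weight 1.
   Transitivity of the higraph makes every subtree contractible to an edge, up
   to the conditions on types.  Both counts vanish unless P is good of weight 2.
   In that case call the excess of a node 1 if it is boundary or its target is
   of type o, and 0 otherwise.  The weight of P is the sum of the excesses, and
   the root has excess 1, so exactly one other node x has excess 1; all the
   remaining nodes are interior with stable target.  Then D D counts the arrow
   out of x, unless it is stable; the interior contractions are the full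
   subtrees hanging at the nodes t between x and the root whose target is
   stable, and P itself if its target is of type o; the only boundary
   contraction is {x, root}.
   Stable arrows end at boundary nodes, so x is at distance at most 2 from the
   root and the parity is checked in each case. *)
Require Import Defs.
From HB Require Import structures.
From mathcomp Require Import all_boot all_order all_algebra.
From mathcomp Require Import zify.
Set Implicit Arguments. Unset Strict Implicit. Unset Printing Implicit Defensive.

(** * Counting along a relation *)

(** Induction on the size of [X], removing one related pair at a time: a removed [y] is related to
    no other element of [X], so the rest keep their partners. A relation is used because the
    correspondences below are given by the existence of embeddings. *)
Lemma leq_card_rel (A B : finType) (X : {set A}) (Y : {set B}) (R : A -> B -> Prop) :
  (forall x, x \in X -> exists2 y, y \in Y & R x y) ->
  (forall x x' y, x \in X -> x' \in X -> y \in Y -> R x y -> R x' y -> x = x') ->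
  #|X| <= #|Y|.
Proof.
have [m] := ubnP #|X|; elim: m X Y => // m IH X Y Xm ex inj; have [-> | [x xX]] := set_0Vmem X.
  by rewrite cards0.
have [y yY xy] := ex x xX.
rewrite (cardsD1 x X) (cardsD1 y Y) xX yY leq_add2l; apply: IH.
- by rewrite (cardsD1 x) xX in Xm.
- move=> x' /setD1P[xx' x'X]; have [y' y'Y xy'] := ex x' x'X.
  exists y' => //; rewrite !inE y'Y andbT; apply: contraNneq xx' => e; subst y'.
  by apply/eqP; apply: (inj x' x y).
- by move=> u v w /setD1P[_ uX] /setD1P[_ vX] /setD1P[_ wY]; apply: inj.
Qed.
Lemma eq_card_rel (A B : finType) (X : {set A}) (Y : {set B}) (R : A -> B -> Prop) :
  (forall x, x \in X -> exists2 y, y \in Y & R x y) ->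
  (forall y, y \in Y -> exists2 x, x \in X & R x y) ->
  (forall x y y', x \in X -> y \in Y -> y' \in Y -> R x y -> R x y' -> y = y') ->
  (forall x x' y, x \in X -> x' \in X -> y \in Y -> R x y -> R x' y -> x = x') ->
  #|X| = #|Y|.
Proof.
move=> exY exX injY injX; apply/eqP; rewrite eqn_leq (leq_card_rel exY injX) /=.
apply: (leq_card_rel (R := fun y x => R x y) exX) => y y' x yY y'Y xX.
exact: injY.
Qed.

(** Matches the double sums over lengths in both coefficients, with [p] and [q] the sizes of the two
    paths attached to a cut or a contraction. *)
Lemma sum_card_fibers (B : finType) (Y : {set B}) n (p q : B -> nat) :
  (forall y, y \in Y -> p y < n /\ q y < n) ->
  \sum_(k < n) \sum_(l < n) #|[set y in Y | (p y == k) && (q y == l)]| = #|Y|.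
Proof.
move=> pq.
have cE (b : pred B) : #|[set y in Y | b y]| = \sum_(y in Y) b y.
  rewrite -sum1_card big_mkcond [RHS]big_mkcond; apply: eq_bigr => y _.
  by rewrite inE; case: (y \in Y) => //; case: (b y).
under eq_bigr => k _ do (under eq_bigr => l _ do rewrite cE; rewrite exchange_big).
rewrite exchange_big /= -sum1_card; apply: eq_bigr => y /pq[py qy].
rewrite (bigD1 (Ordinal py)) //= [X in _ + X]big1 ?addn0; last first.
  move=> k; rewrite -val_eqE /= eq_sym => /negPf npk.
  by rewrite big1 // => l _; rewrite npk.
rewrite (bigD1 (Ordinal qy)) //= !eqxx big1 // => l.
by rewrite -val_eqE /= eq_sym => /negPf ->.
Qed.

Lemma vtype_eqE : ((TO == TU) = false) * ((TO == TS) = false) *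
  ((TU == TO) = false) * ((TU == TS) = false) *
  ((TS == TO) = false) * ((TS == TU) = false).
Proof. by do !split; apply/eqP. Qed.

Section Paths.
Variables (V : finType) (E : {set {set V} * {set V}}).
Hypothesis treeE : tree_like E.

Lemma valid_inj_bs (b : bedge V) x y :
  bedge_valid E b -> x \in bs b -> y \in bs b -> x.1 = y.1 -> x = y.
Proof.
case/and3P=> /andP[/forall_inP H _] _ _ xb yb exy.
by move/forall_inP/(_ y yb): (H x xb); rewrite exy eqxx => /eqP.
Qed.

Lemma valid_bt (b : bedge V) : bedge_valid E b -> exists z, bt b = [set z].
Proof.
case/and3P=> /andP[_ /forall_inP H] eE _.
have := treeE eE; rewrite /ht /= card_in_imset.
  by move/eqP/cards1P.
move=> x y xb yb exy.
by move/forall_inP/(_ y yb): (H x xb); rewrite exy eqxx => /eqP.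
Qed.

(** * Rooted subtrees *)

(* [S] carries a subtree of [P] whose root is [t]; [rt_ind] is induction from
   the root towards the leaves, and encodes connectedness. *)
Record rooted (N : finType) (P : pth V N) (S : {set N}) (t : N) : Prop :=
  Rooted {
    rt_in : t \in S;
    rt_valid : forall v, v \in S -> bedge_valid E (plab P v);
    rt_sub : forall a b, a \in S -> b \in S -> parr P a b ->
      bt (plab P a) \subset bs (plab P b);
    rt_fun : forall a b c, a \in S -> b \in S -> c \in S ->
      parr P a b -> parr P a c -> b = c;
    rt_inj : forall a b c, a \in S -> b \in S -> c \in S ->
      parr P a c -> parr P b c -> bt (plab P a) = bt (plab P b) -> a = b;
    rt_top : forall b, b \in S -> ~~ parr P t b;
    rt_par : forall a, a \in S -> a != t -> exists2 b, b \in S & parr P a b;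
    rt_ind : forall Q : N -> Prop,
      (forall v, v \in S -> (forall w, w \in S -> parr P v w -> Q w) -> Q v) ->
      forall v, v \in S -> Q v }.

Section Rooted.
Variables (N : finType) (P : pth V N) (S : {set N}) (t : N).
Hypothesis rS : rooted P S t.

Lemma rt_bt v : v \in S -> exists z, bt (plab P v) = [set z].
Proof. by move/(rt_valid rS)/valid_bt. Qed.

Lemma rt_alab a b : a \in S -> b \in S -> parr P a b -> alab P a b = bt (plab P a).
Proof. by move=> aS bS /(rt_sub rS aS bS)/setIidPl. Qed.

Lemma rt_irr a : a \in S -> ~~ parr P a a.
Proof.
move: a; apply: (rt_ind rS) => a aS IH; apply/negP => aa.
by move: (IH a aS aa); rewrite aa.
Qed.

Lemma rt_asym a b : a \in S -> b \in S -> parr P a b -> ~~ parr P b a.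
Proof.
move=> aS; move: a aS b.
apply: (rt_ind rS (Q := fun a => forall b, b \in S -> parr P a b -> ~~ parr P b a)).
move=> a aS IH b bS ab; apply/negP => ba.
by move: (IH b bS ab a aS ba); rewrite ab.
Qed.

Lemma rt_sup (T : {set N}) u : T \subset S -> u \in T ->
  (forall v, v \in T -> v != u -> exists2 w, w \in T & parr P v w) ->
  rooted P T u.
Proof.
move=> /subsetP TS uT parT; split=> //.
- by move=> v /TS; apply: (rt_valid rS).
- by move=> a b /TS aS /TS bS; apply: (rt_sub rS).
- by move=> a b c /TS aS /TS bS /TS cS; apply: (rt_fun rS).
- by move=> a b c /TS aS /TS bS /TS cS; apply: (rt_inj rS).
- move=> b bT; apply/negP => ub.
  (* A parent of [u] in [T] would give every node of [T] a parent in [T], and induction from the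
     root of [S] then shows that [T] is empty. *)
  have nT : forall v, v \in S -> v \notin T.
    apply: (rt_ind rS (Q := fun v => v \notin T)) => v vS IH.
    apply/negP => vT.
    have [w wT vw] : exists2 w, w \in T & parr P v w.
      by have [-> | /parT] := eqVneq v u; [exists b | apply].
    by move: (IH w (TS w wT) vw); rewrite wT.
  by move: (nT u (TS u uT)); rewrite uT.
- move=> Q H v vT; have vS := TS v vT; move: v vS vT.
  apply: (rt_ind rS (Q := fun v => v \in T -> Q v)) => v vS IH vT.
  by apply: H => // w wT vw; apply: IH => //; apply: TS.
Qed.

Lemma rt_uniq u : rooted P S u -> u = t.
Proof.
move=> rS'; apply/eqP/negPn/negP => ut.
have [b bS ub] := rt_par rS (rt_in rS') ut.
by move: (rt_top rS' bS); rewrite ub.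
Qed.

End Rooted.

Lemma rooted_up (N : finType) (P : pth V N) r a : rooted P setT r ->
  rooted P [set v | connect (parr P) v a] a.
Proof.
move=> rP; apply: (rt_sup rP); rewrite ?subsetT ?inE //.
move=> v; rewrite inE => /connectP [[|w p] /=]; first by move=> _ ->; rewrite eqxx.
case/andP=> vw wp -> _; exists w => //; rewrite inE.
by apply/connectP; exists p.
Qed.

(** An arrow is determined by its source, and every node except the root is the source of one. *)
Lemma rooted_arrow_card (N : finType) (P : pth V N) t : rooted P setT t ->
  #|[set p : N * N | parr P p.1 p.2]| = #|N| - 1.
Proof.
move=> rP; rewrite -(card_in_imset (f := fst)).
  have -> : [set p.1 | p in [set p : N * N | parr P p.1 p.2]] = [set~ t].
    apply/setP => a; rewrite !inE; apply/imsetP/idP.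
      case=> -[b c]; rewrite inE /= => bc ->; apply: contraTneq bc => ->.
      by rewrite (rt_top rP) ?inE.
    move=> /(rt_par rP (in_setT a)) [b _ ab]; exists (a, b) => //.
    by rewrite inE.
  by rewrite cardsC1 subn1.
move=> [a b] [c d]; rewrite !inE /= => ab cd ac; subst c.
by rewrite (rt_fun rP (in_setT a) (in_setT b) (in_setT d) ab cd).
Qed.

Lemma rooted_path (N : finType) (P : pth V N) t :
  rooted P setT t -> is_path P E.
Proof.
move=> rP; have inT := @in_setT N; apply/and5P; split.
- apply/and5P; split.
  + by apply/card_gt0P; exists t.
  + by apply/forallP => a; apply: (rt_irr rP).
  + apply/forallP => a; apply/forallP => b; apply/negP => /andP[ab ba].
    by move: (rt_asym rP (inT a) (inT b) ab); rewrite ba.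
  + by rewrite (rooted_arrow_card rP).
  + set e : rel N := fun x y => parr P x y || parr P y x; have se : symmetric e.
      by move=> x y; rewrite /e orbC.
    have ct a : connect e a t.
      move: a (inT a); apply: (rt_ind rP) => a _ IH.
      have [-> // | at'] := eqVneq a t.
      have [b _ ab] := rt_par rP (inT a) at'.
      apply: connect_trans (IH b (inT b) ab).
      by apply: connect1; rewrite /e ab.
    apply/forallP => a; apply/forallP => b; apply: connect_trans (ct a) _.
    by rewrite (sym_connect_sym se).
- by apply/forallP => v; apply: (rt_valid rP).
- apply/forallP => a; apply/forallP => b; apply/implyP => ab.
  rewrite (rt_alab rP) //; have [z ->] := rt_bt rP (inT a).
  by rewrite cards1.
- apply/forallP => a; apply/forallP => b; apply/forallP => c.
  apply/implyP => /and3P[ab ac].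
  by rewrite (rt_fun rP (inT a) (inT b) (inT c) ab ac) eqxx.
- apply/forallP => a; apply/forallP => b; apply/forallP => c.
  apply/implyP => /and3P[ac bc nab]; rewrite !(rt_alab rP) //.
  apply: contra nab => /eqP e; apply/eqP.
  exact: (rt_inj rP (inT a) (inT b) (inT c)).
Qed.

(** Two arrows out of a node would both be labelled by its single target vertex, so every node has
    at most one outgoing arrow. As there are [#|N| - 1] arrows, exactly one node has none, and it is
    the root. *)
Lemma path_rooted (N : finType) (P : pth V N) :
  is_path P E -> exists t, rooted P setT t.
Proof.
case/and5P=> /and5P[N0 irr asym /eqP carr conn] val lab1 dout din.
have inT := @in_setT N.
have valP v : bedge_valid E (plab P v) by apply: (forallP val).
have subP a b : parr P a b -> bt (plab P a) \subset bs (plab P b).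
  move=> ab; move/forallP/(_ a)/forallP/(_ b): lab1; rewrite ab /alab /=.
  have [z ->] := valid_bt (valP a).
  rewrite sub1set => /cards1P[y ey].
  by have : y \in [set y] := set11 y; rewrite -ey !inE => /andP[/eqP<-].
have alabE a b : parr P a b -> alab P a b = bt (plab P a).
  by move/subP/setIidPl.
have funP a b c : parr P a b -> parr P a c -> b = c.
  move=> ab ac; apply/eqP/negPn/negP => bc.
  move/forallP/(_ a)/forallP/(_ b)/forallP/(_ c): dout.
  by rewrite ab ac bc !alabE //= eqxx.
have injP a b c : parr P a c -> parr P b c ->
    bt (plab P a) = bt (plab P b) -> a = b.
  move=> ac bc e; apply/eqP/negPn/negP => ab.
  move/forallP/(_ a)/forallP/(_ b)/forallP/(_ c): din.
  by rewrite ab ac bc !alabE //= e eqxx.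
set D := [set p.1 | p in [set p : N * N | parr P p.1 p.2]].
have cD : #|D| = #|N| - 1.
  rewrite -carr card_in_imset // => -[a b] [c d]; rewrite !inE /= => ab cd ac.
  by subst c; rewrite (funP _ _ _ ab cd).
have inD a : (a \in D) = [exists b, parr P a b].
  apply/imsetP/existsP; first by case=> -[x b]; rewrite inE /= => xb ->; exists b.
  by case=> b ab; exists (a, b); rewrite ?inE.
have /cards1P [t et] : #|~: D| == 1 by rewrite cardsCs setCK cD; apply/eqP; lia.
have tD : t \notin D by rewrite -in_setC et set11.
have parP a : a != t -> exists b, parr P a b.
  move=> at'; apply/existsP; rewrite -inD; apply: contraNT at'.
  by rewrite -in_setC et inE.
exists t; split => //.
- by move=> a b _ _; apply: subP.
- by move=> a b c _ _ _; apply: funP.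
- by move=> a b c _ _ _; apply: injP.
- by move=> b _; apply: contra tD => tb; rewrite inD; apply/existsP; exists b.
- by move=> a _ /parP[b ab]; exists b.
move=> Q H.
have ind a : connect (parr P) a t -> Q a.
  case/connectP=> p; elim: p a => [|b p IH] a /=.
    move=> _ <-; apply: H => // w _ tw; case/negP: tD; rewrite inD.
    by apply/existsP; exists w.
  case/andP=> ab bp et'; apply: H => // w _ aw.
  by rewrite -(funP _ _ _ ab aw); apply: IH.
move=> v _; apply: ind; set e : rel N := fun x y => parr P x y || parr P y x in conn.
have : connect e v t by move/forallP/(_ v)/forallP/(_ t): conn.
case/connectP=> p; elim: p v => [|b p IH] a /=; first by move=> _ ->.
case/andP=> ab bp et'; have bt := IH b bp et'.
case/orP: ab => [ab|ba]; first exact: connect_trans (connect1 ab) bt.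
(* The undirected walk uses the arrow from [b] to [a] backwards: as this is the only arrow out of
   [b], the directed path from [b] to [t] goes through [a]. *)
case/connectP: bt => -[|c q] /=.
  by move=> _ e0; case/negP: tD; rewrite inD e0; apply/existsP; exists a.
case/andP=> bc cq e0; rewrite (funP _ _ _ ba bc).
by apply/connectP; exists q.
Qed.

(** Relative version of the source of a path, in which only arrows starting in [S] use up vertices.
    Subtrees thus stay node sets of one ambient [P]. *)
Definition ssrc (N : finType) (P : pth V N) (S : {set N}) (v : N) :=
  bs (plab P v) :\: \bigcup_(a in S | parr P a v) alab P a v.

Definition src (N : finType) (P : pth V N) (S : {set N}) :=
  \bigcup_(v in S) ssrc P S v.

Lemma ssrcP (N : finType) (P : pth V N) S t z v : rooted P S t -> v \in S ->
  reflect (z \in bs (plab P v) /\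
           forall a, a \in S -> parr P a v -> z \notin bt (plab P a))
          (z \in ssrc P S v).
Proof.
move=> rS vS; apply: (iffP setDP) => -[zv H]; split=> //.
  move=> a aS av; apply: contra H => za; apply/bigcupP; exists a; rewrite ?aS //.
  by rewrite (rt_alab rS).
apply/bigcupP => -[a /andP[aS av]]; rewrite (rt_alab rS) //.
exact/negP/H.
Qed.

(** Every node other than the root passes its only target vertex on to its parent, so nothing but
    the target of the root is left over. *)
Lemma ptgt_rooted (N : finType) (P : pth V N) t : rooted P setT t ->
  forall z v, targeted P z v = (v == t) && (z \in bt (plab P t)).
Proof.
move=> rP z v; rewrite /targeted !inE; have inT := @in_setT N.
have [-> | vt] := eqVneq v t.
  suff -> : outlab P t = set0 by rewrite in_set0.
  apply/eqP; rewrite -subset0; apply/subsetP => y /bigcupP[b tb _].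
  by move: (rt_top rP (inT b)); rewrite tb.
have [b _ vb] := rt_par rP (inT v) vt.
apply/negP => /andP[/negP nz zv]; apply: nz; apply/bigcupP; exists b => //.
by rewrite (rt_alab rP).
Qed.

Lemma ptgt_root (N : finType) (P : pth V N) t : rooted P setT t ->
  ptgt P = bt (plab P t).
Proof.
move=> rP; apply/setP => z; apply/bigcupP/idP.
  by case=> v _; rewrite -/(targeted P z v) (ptgt_rooted rP) => /andP[].
by move=> zt; exists t => //; rewrite -/(targeted P z t) (ptgt_rooted rP) eqxx.
Qed.

(** * Embeddings and canonical representatives *)

Section Embeddings.
Variables (M N : finType) (Q : pth V M) (P : pth V N) (f : M -> N).

(** Arrows are reflected as well as preserved: [Q] is a copy of the subgraph of [P] on the image of
    [f], so its invariants can be computed on that node set. *)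
Record emb : Prop := Emb {
  emb_inj : injective f;
  emb_lab : forall x, plab P (f x) = plab Q x;
  emb_arr : forall x y, parr P (f x) (f y) = parr Q x y }.

Hypothesis fP : emb.
Local Notation S := (f @: setT).

Let inS x : f x \in S. Proof. by rewrite imset_f. Qed.

Lemma emb_alab x y : alab P (f x) (f y) = alab Q x y.
Proof. by rewrite /alab !(emb_lab fP). Qed.

Lemma emb_sourced z x : sourced Q z x = (z \in ssrc P S (f x)).
Proof.
rewrite /sourced /ssrc (emb_lab fP) !inE; congr (~~ _ && _).
apply/bigcupP/bigcupP => -[].
  move=> a ax za; exists (f a); first by rewrite inS (emb_arr fP).
  by rewrite emb_alab.
move=> _ /andP[/imsetP[a _ ->]]; rewrite (emb_arr fP) emb_alab => ax za.
by exists a.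
Qed.

Lemma emb_psrc : psrc Q = src P S.
Proof.
apply/setP => z; apply/bigcupP/bigcupP => -[].
  by move=> x _ zx; exists (f x) => //; rewrite -emb_sourced.
by move=> _ /imsetP[x _ ->]; rewrite -emb_sourced => zx; exists x.
Qed.

Lemma emb_rooted t : rooted Q setT t <-> rooted P S (f t).
Proof.
have inT := @in_setT M.
split=> [rQ | rP]; split=> //.
- by move=> _ /imsetP[x _ ->]; rewrite (emb_lab fP); apply: (rt_valid rQ).
- move=> _ _ /imsetP[x _ ->] /imsetP[y _ ->]; rewrite (emb_arr fP) !(emb_lab fP).
  exact: (rt_sub rQ).
- move=> _ _ _ /imsetP[x _ ->] /imsetP[y _ ->] /imsetP[z _ ->].
  by rewrite !(emb_arr fP) => xy xz; rewrite (rt_fun rQ (inT x) (inT y) (inT z)).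
- move=> _ _ _ /imsetP[x _ ->] /imsetP[y _ ->] /imsetP[z _ ->].
  rewrite !(emb_arr fP) !(emb_lab fP) => xz yz e.
  by rewrite (rt_inj rQ (inT x) (inT y) (inT z) xz yz).
- by move=> _ /imsetP[y _ ->]; rewrite (emb_arr fP) (rt_top rQ).
- move=> _ /imsetP[x _ ->]; rewrite (inj_eq (emb_inj fP)).
  case/(rt_par rQ (inT x))=> y _ xy; exists (f y) => //.
  by rewrite (emb_arr fP).
- move=> R H _ /imsetP[x _ ->]; move: x (inT x).
  apply: (rt_ind rQ (Q := fun x => R (f x))) => x _ IH; apply: H => //.
  move=> _ /imsetP[y _ ->]; rewrite (emb_arr fP); exact: IH.
- by move=> x _; rewrite -(emb_lab fP); apply: (rt_valid rP).
- move=> x y _ _; rewrite -(emb_arr fP) -!(emb_lab fP); exact: (rt_sub rP).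
- move=> x y z _ _ _; rewrite -!(emb_arr fP) => xy xz.
  by apply: (emb_inj fP); apply: (rt_fun rP _ _ _ xy xz).
- move=> x y z _ _ _; rewrite -!(emb_arr fP) -!(emb_lab fP) => xz yz e.
  by apply: (emb_inj fP); apply: (rt_inj rP _ _ _ xz yz e).
- by move=> y _; rewrite -(emb_arr fP); apply: (rt_top rP).
- move=> x _; rewrite -(inj_eq (emb_inj fP)) => /(rt_par rP (inS x)).
  by case=> _ /imsetP[y _ ->]; rewrite (emb_arr fP) => xy; exists y.
- move=> R H x _; suff: forall v, v \in S -> forall x, v = f x -> R x.
    by move/(_ _ (inS x)); apply.
  apply: (rt_ind rP (Q := fun v => forall x, v = f x -> R x)) => v vS IH y vy.
  apply: H => // w _ yw; apply: (IH (f w)) => //.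
  by rewrite vy (emb_arr fP).
Qed.

Lemma emb_pathP : is_path Q E <-> exists t, rooted P S t.
Proof.
split=> [/path_rooted[t /emb_rooted rt] | [t rt]]; first by exists (f t).
have /imsetP[x _ tx] := rt_in rt; subst t.
by move/emb_rooted: rt => /rooted_path.
Qed.

Lemma emb_pweight : pweight Q = (\sum_(v in S) bweight (plab P v))%R.
Proof.
rewrite big_imset /=; last by move=> x y _ _; apply: (emb_inj fP).
by apply: eq_big => [x|x _]; rewrite ?inE ?(emb_lab fP).
Qed.

Lemma emb_card : #|S| = #|M|.
Proof. by rewrite card_imset ?cardsT //; apply: (emb_inj fP). Qed.

End Embeddings.

Lemma emb_id (N : finType) (P : pth V N) : emb P P id.
Proof. by split. Qed.

Lemma emb_comp (A B C : finType) (PA : pth V A) (PB : pth V B) (PC : pth V C)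
  f g : emb PA PB f -> emb PB PC g -> emb PA PC (g \o f).
Proof.
move=> fP gP; split=> [|x|x y] /=.
- exact: inj_comp (emb_inj gP) (emb_inj fP).
- by rewrite (emb_lab gP) (emb_lab fP).
- by rewrite (emb_arr gP) (emb_arr fP).
Qed.

(** Induction from the root: a node is determined by its parent and its target vertex, because
    arrows into one node have distinct labels. *)
Lemma emb_rigid (M N : finType) (Q : pth V M) (P : pth V N) f g t :
  emb Q P f -> emb Q P g -> f @: setT = g @: setT ->
  rooted P (f @: setT) t -> f =1 g.
Proof.
move=> fP gP efg rS.
have fS x : f x \in f @: setT by rewrite imset_f.
have gS x : g x \in f @: setT by rewrite efg imset_f.
suff H p : p \in f @: setT -> forall x, f x = p -> g x = p.
  by move=> x; rewrite (H _ (fS x) x).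
move: p; apply: (rt_ind rS (Q := fun p => forall x, f x = p -> g x = p)).
move=> p pS IH x xp; have [pt | pt] := eqVneq p t.
  (* A parent of [g x] inside the common image would come from an arrow out of [x] in [Q], which [f]
     would send to an arrow out of the root [t]. *)
  rewrite pt; apply/eqP/negPn/negP => gt.
  have [w wS] := rt_par rS (gS x) gt.
  have /imsetP[y _ ->] : w \in g @: setT by rewrite -efg.
  rewrite (emb_arr gP) -(emb_arr fP) xp pt => ty.
  by move: (rt_top rS (fS y)); rewrite ty.
have [_ /imsetP[y _ ->] py] := rt_par rS pS pt.
have gy := IH _ (fS y) py y (erefl _).
apply: (rt_inj rS (gS x) pS (fS y)) => //.
  by rewrite -gy (emb_arr gP) -(emb_arr fP) xp.
by rewrite (emb_lab gP) -xp (emb_lab fP).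
Qed.

Lemma pisoP (M N : finType) (Q : pth V M) (P : pth V N) :
  reflect (exists2 f, emb Q P f & f @: setT = setT) (piso Q P).
Proof.
apply: (iffP existsP) => [[f] | [f fP fT]].
  case/and4P=> /injectiveP fi /eqP cMN /forallP fl /forallP fa.
  exists f.
    split=> // [x|x y]; first exact/eqP.
    by apply/eqP; move: y; apply/forallP.
  by apply/eqP; rewrite eqEcard subsetT card_imset // !cardsT cMN /=.
have fE : [ffun x => f x] =1 f by move=> x; rewrite ffunE.
exists [ffun x => f x]; apply/and4P; split.
- by apply/injectiveP => x y; rewrite !fE; apply: (emb_inj fP).
- by rewrite -(emb_card fP) fT cardsT.
- by apply/forallP => x; rewrite fE (emb_lab fP).
- by apply/forallP => x; apply/forallP => y; rewrite !fE (emb_arr fP).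
Qed.

(** As [g] is injective with the same image, [f] factors through it. Together with [canon_eq] this
    identifies canonical paths embedded onto the same node set. *)
Lemma emb_inv (M N L : finType) (Q : pth V M) (R : pth V L) (P : pth V N) f g :
  emb Q P f -> emb R P g -> f @: setT = g @: setT ->
  exists h, [/\ emb Q R h, h @: setT = setT & g \o h =1 f].
Proof.
move=> fP gP efg.
have H x : exists y, g y == f x.
  have : f x \in g @: setT by rewrite -efg imset_f.
  by case/imsetP=> y _ e; exists y; rewrite e.
pose h x := xchoose (H x).
have hE x : g (h x) = f x by apply/eqP; exact: (xchooseP (H x)).
exists h; split=> //.
  split=> [x y e|x|x y].
  - by apply: (emb_inj fP); rewrite -!hE e.
  - by rewrite -(emb_lab gP) hE (emb_lab fP).
  - by rewrite -(emb_arr gP) !hE (emb_arr fP).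
apply/setP => y; rewrite inE; apply/imsetP.
have : g y \in f @: setT by rewrite efg imset_f.
case/imsetP=> x _ e; exists x => //.
by apply: (emb_inj gP); rewrite hE.
Qed.

Lemma piso_sym (M N : finType) (Q : pth V M) (P : pth V N) :
  piso Q P -> piso P Q.
Proof.
case/pisoP=> f fP fT; apply/pisoP.
have [|h [hP hT _]] := emb_inv (emb_id P) fP; first by rewrite fT imset_id.
by exists h.
Qed.

Lemma piso_trans (A B C : finType) (PA : pth V A) (PB : pth V B) (PC : pth V C) :
  piso PA PB -> piso PB PC -> piso PA PC.
Proof.
case/pisoP=> f fP fT /pisoP[g gP gT]; apply/pisoP; exists (g \o f).
  exact: emb_comp fP gP.
by rewrite imset_comp fT.
Qed.

Lemma canon_eq k (c d : CP V k) : canon c -> canon d ->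
  piso (cp2p c) (cp2p d) -> c = d.
Proof.
move=> /forallP/(_ d)/implyP cc /forallP/(_ c)/implyP cd i.
apply: enum_rank_inj; apply: val_inj; apply/eqP.
by rewrite eqn_leq cc // cd //; apply: piso_sym.
Qed.

(** [S] is numbered by [enum_val], and the numbered copy is replaced by the member of its
    isomorphism class of least rank. *)
Lemma canon_ex (N : finType) (P : pth V N) (S : {set N}) k : #|S| = k ->
  exists c : CP V k, canon c /\ exists2 f, emb (cp2p c) P f & f @: setT = S.
Proof.
move=> cS; subst k.
pose g : 'I_#|S| -> N := enum_val.
pose c0 : CP V #|S| := ([ffun i => plab P (g i)],
                        [ffun p => parr P (g p.1) (g p.2)]).
have gP : emb (cp2p c0) P g.
  split=> [x y /enum_val_inj //|x|x y]; by rewrite /= ffunE.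
have gS : g @: setT = S.
  apply/setP => x; apply/imsetP/idP => [[i _ ->]|xS]; first exact: enum_valP.
  by exists (enum_rank_in xS x); rewrite // /g enum_rankK_in.
case: (arg_minnP (P := fun d : CP V #|S| => piso (cp2p d) (cp2p c0))
   (fun d : CP V #|S| => enum_rank d)
   (i0 := c0)); first by apply/pisoP; exists id; [exact: emb_id | rewrite imset_id].
move=> c /[dup] cc /pisoP[h hP hT] cmin; exists c; split.
  apply/forallP => d; apply/implyP => cd; apply: cmin.
  exact: piso_trans (piso_sym cd) cc.
by exists (g \o h); [exact: emb_comp gP | rewrite imset_comp hT gS].
Qed.

(** * Sources of subtrees *)

Hypothesis transE : higraph_transitive E.

(** The first clause makes [S] contractible to an edge of the higraph. The second says that the
    projection to [V] stays injective on the sources of all nodes together; the induction needs it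
    to see which source vertex a new leaf uses up. *)
Definition composite (N : finType) (P : pth V N) (S : {set N}) (t : N) :=
  ((fst @: src P S, fst @: bt (plab P t)) \in E) /\
  forall v v' z z', v \in S -> v' \in S -> z \in ssrc P S v ->
    z' \in ssrc P S v' -> z.1 = z'.1 -> z = z' /\ v = v'.

(** Transitivity is applied to the edge of the new leaf [c] and the edge of [T]: they meet in the
    projection of the target vertex [z0] of [c], and the disjointness of sources that it provides
    preserves injectivity. *)
Lemma composite_step (N : finType) (P : pth V N) (T : {set N}) t c p :
  rooted P T t -> rooted P (c |: T) t -> c \notin T -> p \in T -> parr P c p ->
  composite P T t -> composite P (c |: T) t.
Proof.
move=> rT rT' cT pT cp [eT iT].
have cT' : c \in c |: T by rewrite setU11.
have TT' v : v \in T -> v \in c |: T by apply: setU1r.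
have [z0 ez0] := rt_bt rT' cT'.
(* Each node of [T] except [t] has its one arrow inside [T], and [t] has none, so nothing in [T]
   points to [c]. *)
have leafc a : a \in c |: T -> ~~ parr P a c.
  rewrite in_setU1 => /predU1P[-> | aT]; first exact: (rt_irr rT').
  have [-> | at'] := eqVneq a t; first exact: (rt_top rT').
  have [w wT aw] := rt_par rT aT at'; apply: contra cT => ac.
  by rewrite (rt_fun rT' _ _ _ ac aw) // TT'.
have srcc : ssrc P (c |: T) c = bs (plab P c).
  apply/setP => z; apply/(ssrcP _ rT' cT')/idP => [[]|zc] //; split=> // a aT ac.
  by move: (leafc a aT); rewrite ac.
(* A child of [p] in [T] with target [z0] would have to be [c], so [z0] is still a free source
   vertex of [T]. *)
have z0p : z0 \in ssrc P T p.
  apply/(ssrcP _ rT pT); split.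
    by have /subsetP := rt_sub rT' cT' (TT' p pT) cp; apply; rewrite ez0 set11.
  move=> a aT ap; apply: contra cT => z0a.
  rewrite (rt_inj rT' cT' (TT' a aT) (TT' p pT)) // ez0.
  have [y ey] := rt_bt rT aT.
  by move: z0a; rewrite ey inE => /eqP->.
have srcv v z : v \in T -> (z \in ssrc P (c |: T) v) = (z \in ssrc P T v) && (z != z0).
  move=> vT; apply/(ssrcP _ rT' (TT' v vT))/andP.
    case=> zv H; split.
      by apply/(ssrcP _ rT vT); split=> // a aT; apply: H; apply: TT'.
    apply/eqP => zz0; subst z.
    have zT : z0 \in ssrc P T v.
      by apply/(ssrcP _ rT vT); split=> // a aT; apply: H; apply: TT'.
    have [_ pv] := iT p v z0 z0 pT vT z0p zT erefl; subst v.
    by move: (H c cT' cp); rewrite ez0 set11.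
  case=> /(ssrcP _ rT vT) [zv H] nz; split=> // a.
  rewrite in_setU1 => /predU1P[-> _ | ]; last exact: H.
  by rewrite ez0 inE.
have inj0 v z : v \in T -> z \in ssrc P T v -> z.1 = z0.1 -> z = z0.
  by move=> vT zv e; case: (iT v p z z0).
have [_ cE _] := and3P (rt_valid rT' cT').
have [|K] := transE cE eT.
  apply/set0Pn; exists z0.1; rewrite inE /ht /hs /= ez0 imset_set1 set11.
  by apply: imset_f; apply/bigcupP; exists p.
rewrite /ht /hs /= ez0 imset_set1 => -[eK dsrc _ eE].
have {}eK : K = z0.1.
  by have : K \in [set K] := set11 K; rewrite -eK !inE => /andP[/eqP].
subst K; split.
  rewrite setDv set0U in eE; move: eE.
  suff -> : fst @: bs (plab P c) :|: fst @: src P T :\ z0.1 =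
            fst @: src P (c |: T) by [].
  apply/setP => k; rewrite !inE; apply/orP/imsetP.
    case=> [/imsetP[z zc ->] | /andP[kz /imsetP[z /bigcupP[v vT zv] e]]].
      by exists z => //; apply/bigcupP; exists c; rewrite ?srcc.
    exists z => //; apply/bigcupP; exists v; first exact: TT'.
    by rewrite srcv // zv; apply: contraNneq kz => <-; rewrite e.
  case=> z /bigcupP[v]; rewrite in_setU1 => /predU1P[-> | vT].
    by rewrite srcc => zc ->; left; apply: imset_f.
  rewrite srcv // => /andP[zv nz] ->; right; apply/andP; split.
    by apply: contraNneq nz => e; rewrite (inj0 v z).
  by apply: imset_f; apply/bigcupP; exists v.
have dis z z' v : z \in bs (plab P c) -> v \in T -> z' \in ssrc P (c |: T) v ->
    z.1 <> z'.1.
  move=> zc vT; rewrite srcv // => /andP[zv nz] e.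
  have := disjointFr dsrc (imset_f fst zc); rewrite e !inE => /negP; apply.
  apply/andP; split; first by apply: contraNneq nz => e'; rewrite (inj0 v z').
  by apply: imset_f; apply/bigcupP; exists v.
move=> v v' z z'; rewrite !in_setU1.
case/predU1P=> [->|vT] /predU1P[->|v'T].
- rewrite srcc => zc z'c e; split=> //.
  exact: (valid_inj_bs (rt_valid rT' cT')).
- by rewrite srcc => zc zv' /(dis _ _ _ zc v'T zv').
- by rewrite srcc => zv zc /esym /(dis _ _ _ zc vT zv).
- by rewrite !srcv // => /andP[zv _] /andP[zv' _]; apply: iT.
Qed.

(** Transitivity composes only two edges, so the subtree is grown from its root by one node at a
    time. *)
Lemma rooted_composite (N : finType) (P : pth V N) S t :
  rooted P S t -> composite P S t.
Proof.
move=> rS; have tS := rt_in rS.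
suff H k : k < #|S| -> exists T : {set N}, [/\ T \subset S, #|T| = k.+1, t \in T,
    forall v, v \in T -> v != t -> exists2 w, w \in T & parr P v w
    & composite P T t].
  have S0 : 0 < #|S| by apply/card_gt0P; exists t.
  have [|T [TS cT _ _ comp]] := H #|S|.-1; first by rewrite prednK.
  have TeS : T = S by apply/eqP; rewrite eqEcard TS cT prednK /=.
  by rewrite -TeS.
elim: k => [_|k IH kS].
  exists [set t]; rewrite sub1set cards1 set11; split=> //.
    by move=> v; rewrite inE => ->.
  have r1 : rooted P [set t] t.
    apply: (rt_sup rS); rewrite ?sub1set ?set11 // => v.
    by rewrite inE => ->.
  have s1 : ssrc P [set t] t = bs (plab P t).
    apply/setP => z; apply/(ssrcP _ r1 (set11 t))/idP => [[]|zt] //.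
    by split=> // a; rewrite inE => /eqP-> tt; move: (rt_irr rS tS); rewrite tt.
  split; first by rewrite /src big_set1 s1; case/and3P: (rt_valid rS tS).
  move=> v v' z z' /set1P-> /set1P->; rewrite s1 => zt zt' e; split=> //.
  exact: (valid_inj_bs (rt_valid rS tS)).
have {IH} [T [TS cT tT parT comp]] := IH (ltnW kS).
have rT := rt_sup rS TS tT parT.
have TSP := subsetP TS.
(* If no node outside [T] had its parent in [T], induction from the root would put all of [S] into
   [T]. *)
have [c cST [p pT cp]] : exists2 c, c \in S :\: T & exists2 p, p \in T & parr P c p.
  have [/exists_inP[c cST /exists_inP[p pT cp]]|nH] :=
    boolP [exists c in S :\: T, [exists p in T, parr P c p]].
    by exists c => //; exists p.
  suff ST : S \subset T by move: (subset_leq_card ST); rewrite cT leqNgt kS.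
  apply/subsetP; apply: (rt_ind rS (Q := fun v => v \in T)) => v vS IH.
  have [-> //|vt] := eqVneq v t.
  have [w wS vw] := rt_par rS vS vt.
  apply: contraR nH => vT; apply/exists_inP; exists v; first by rewrite inE vT.
  by apply/exists_inP; exists w => //; apply: IH.
case/setDP: cST => cS cT'.
have TS' : c |: T \subset S by rewrite subUset sub1set cS.
have par' v : v \in c |: T -> v != t -> exists2 w, w \in c |: T & parr P v w.
  rewrite in_setU1 => /predU1P[-> _|vT /(parT v vT) [w wT vw]].
    by exists p => //; rewrite setU1r.
  by exists w => //; rewrite setU1r.
have rT' := rt_sup rS TS' (setU1r c tT) par'.
exists (c |: T); split=> //; first by rewrite cardsU1 cT' cT.
  exact: setU1r.
exact: composite_step rT rT' cT' pT cp comp.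
Qed.

Definition no_stable (X : {set bvert V}) := [forall x in X, x.2 != TS].

Definition wt (N : finType) (P : pth V N) (S : {set N}) : int :=
  (\sum_(v in S) bweight (plab P v))%R.

Lemma emb_ptgt (M N : finType) (Q : pth V M) (P : pth V N) f t :
  emb Q P f -> rooted P (f @: setT) t -> ptgt Q = bt (plab P t).
Proof.
move=> fP rS; have /imsetP[x _ tx] := rt_in rS; subst t.
by move/(emb_rooted fP)/ptgt_root: rS => ->; rewrite (emb_lab fP).
Qed.

Lemma emb_inD k (c : CP V k) (N : finType) (P : pth V N) f t :
  emb (cp2p c) P f -> rooted P (f @: setT) t ->
  inD E c = [&& canon c, no_stable (src P (f @: setT) :|: bt (plab P t))
              & wt P (f @: setT) == 1%R].
Proof.
move=> fP rS; rewrite /inD /basis.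
have -> : is_path (cp2p c) E by apply/(emb_pathP fP); exists t.
by rewrite andbT /pgood (emb_psrc fP) (emb_ptgt fP rS) (emb_pweight fP).
Qed.

(** * Products *)

Section Cuts.
Variables (N : finType) (P : pth V N) (r : N).
Hypothesis rP : rooted P setT r.
Let inT := @in_setT N.

Definition up a := [set v | connect (parr P) v a].

Lemma up_closed a c v : v \in up a -> parr P c v -> c \in up a.
Proof. by rewrite !inE => va cv; apply: connect_trans (connect1 cv) va. Qed.

Lemma closed_up S a : rooted P S a ->
  (forall c v, v \in S -> parr P c v -> c \in S) -> S = up a.
Proof.
move=> rS clS; apply/setP => v; rewrite inE; apply/idP/idP.
  move: v; apply: (rt_ind rS (Q := fun v => connect (parr P) v a)) => v vS IH.
  have [-> //|va] := eqVneq v a; have [w wS vw] := rt_par rS vS va.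
  exact: connect_trans (connect1 vw) (IH w wS vw).
case/connectP=> p; elim: p v => [|w p IH] v /=.
  by move=> _ <-; apply: (rt_in rS).
by case/andP=> vw wp e; apply: (clS v w) => //; apply: IH.
Qed.

Lemma up_root : up r = setT.
Proof. by rewrite -(closed_up rP) // => c v _ _; rewrite inE. Qed.

Lemma root_notin_up a : a != r -> r \notin up a.
Proof.
move=> ar; rewrite inE; apply/negP => /connectP[[|b p] /=].
  by move=> _ e; rewrite e eqxx in ar.
by case/andP=> rb; move: (rt_top rP (inT b)); rewrite rb.
Qed.

Lemma rooted_down a : a != r -> rooted P (~: up a) r.
Proof.
move=> ar; apply: (rt_sup rP); rewrite ?subsetT // ?inE.
  by have := root_notin_up ar; rewrite inE.
move=> v va vr; have [w _ vw] := rt_par rP (inT v) vr; exists w => //.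
rewrite inE; apply: contraTN va => wa; rewrite inE negbK.
exact: up_closed wa vw.
Qed.

Lemma up_inj : injective up.
Proof.
move=> a b e; apply: (@rt_uniq _ P (up b)); first exact: rooted_up rP.
by rewrite -e; apply: rooted_up rP.
Qed.

Section Product.
Variables (M1 M2 : finType) (Q1 : pth V M1) (Q2 : pth V M2).

(** The arrow that the product adds is the arrow from [a] to its parent [p]: the target vertex [z]
    of [a] is the whole target of the first factor, and [rooted_composite] shows that [p] alone
    sources it in the second. *)
Lemma cut_pmul f1 f2 a : a != r -> emb Q1 P f1 -> emb Q2 P f2 ->
  f1 @: setT = up a -> f2 @: setT = ~: up a ->
  mulable Q1 Q2 /\
  let f x := match x with inl y => f1 y | inr y => f2 y end in
  emb (pmul Q1 Q2) P f /\ f @: setT = setT.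
Proof.
move=> ar fP1 fP2 im1 im2.
have r1 : rooted P (f1 @: setT) a by rewrite im1; apply: rooted_up rP.
have r2 : rooted P (f2 @: setT) r by rewrite im2; apply: rooted_down.
have /imsetP[t1 _ at1] := rt_in r1.
have r1' : rooted Q1 setT t1 by apply/(emb_rooted fP1); rewrite -at1.
have in1 x : f1 x \in up a by rewrite -im1 imset_f.
have in2 x : f2 x \in ~: up a by rewrite -im2 imset_f.
have in2' x : f2 x \notin up a by have := in2 x; rewrite in_setC.
have [p _ ap] := rt_par rP (inT a) ar.
have [z ez] := rt_bt rP (inT a).
have pU : p \in ~: up a.
  rewrite in_setC; apply: contraTN ap => pU.
  by have := rt_top (rooted_up a rP); apply.
have zp : z \in ssrc P (~: up a) p.
  apply/(ssrcP _ (rooted_down ar) pU); split.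
    by have /subsetP := rt_sub rP (inT a) (inT p) ap; apply; rewrite ez set11.
  move=> b; rewrite in_setC => bU bp; apply: contra bU => zb.
  suff -> : b = a by rewrite inE.
  apply: (rt_inj rP (inT b) (inT a) (inT p)) => //; rewrite ez.
  by have [y ey] := rt_bt rP (inT b); move: zb; rewrite ey inE => /eqP->.
have pt : ptgt Q1 = [set z] by rewrite (emb_ptgt fP1 r1).
have ps : z \in psrc Q2.
  by rewrite (emb_psrc fP2) im2; apply/bigcupP; exists p.
have tg K x : targeted Q1 K x = (x == t1) && (K == z).
  by rewrite (ptgt_rooted r1') -(emb_lab fP1) -at1 ez inE.
split; first by rewrite /mulable pt (setIidPl _) ?cards1 // sub1set.
move=> f; split; first split.
- case=> x [] y /= e.
  + by rewrite (emb_inj fP1 e).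
  + by move: (in2' y); rewrite -e in1.
  + by move: (in2' x); rewrite e in1.
  + by rewrite (emb_inj fP2 e).
- by case=> x /=; rewrite ?(emb_lab fP1) ?(emb_lab fP2).
- case=> x [] y /=.
  + exact: (emb_arr fP1).
  + apply/idP/existsP.
      (* Any node of [up P a] other than [a] already has its unique parent there. *)
      move=> xy; have fxa : f1 x = a.
        apply/eqP/negPn/negP => xa.
        have [w wU xw] := rt_par (rooted_up a rP) (in1 x) xa.
        move: (in2' y); rewrite -(rt_fun rP (inT (f1 x)) _ _ xw xy) ?inT //.
        by rewrite wU.
      exists z; rewrite inE pt set11 ps tg eqxx andbT /=.
      rewrite -(inj_eq (emb_inj fP1)) -at1 fxa eqxx /=.
      rewrite (emb_sourced fP2) im2; rewrite fxa in xy.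
      by rewrite (rt_fun rP (inT a) (inT (f2 y)) (inT p) xy ap).
    case=> K /andP[/andP[_]]; rewrite tg => /andP[/eqP-> /eqP->].
    rewrite (emb_sourced fP2) im2 -at1 => zy.
    have [_ /(_ _ _ _ _ (in2 y) pU zy zp)] := rooted_composite (rooted_down ar).
    by case=> // _ ->.
  + by apply: contraNF (in2' x) => /(up_closed (in1 y)).
  + exact: (emb_arr fP2).
- apply/setP => v; rewrite inE; apply/imsetP.
  have : v \in up a :|: ~: up a by rewrite setUCr inE.
  rewrite -im2 -im1 => /setUP[] /imsetP[x _ ->].
  + by exists (inl x).
  + by exists (inr x).
Qed.

(** A product has no arrow from the second factor to the first, so the image of the first is closed
    under children and is a full subtree. *)
Lemma pmul_cut f : is_path Q1 E -> is_path Q2 E -> emb (pmul Q1 Q2) P f ->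
  f @: setT = setT -> exists a, [/\ a != r, emb Q1 P (f \o inl), emb Q2 P (f \o inr),
   (f \o inl) @: setT = up a & (f \o inr) @: setT = ~: up a].
Proof.
move=> p1 p2 fP fT.
have fP1 : emb Q1 P (f \o inl).
  split=> [x y /(emb_inj fP) []|x|x y] //=; first by rewrite (emb_lab fP).
  by rewrite (emb_arr fP).
have fP2 : emb Q2 P (f \o inr).
  split=> [x y /(emb_inj fP) []|x|x y] //=; first by rewrite (emb_lab fP).
  by rewrite (emb_arr fP).
have fS v : exists x, v = f x.
  by have : v \in f @: setT by [rewrite fT inE]; case/imsetP=> x _ ->; exists x.
have [a ra] := (emb_pathP fP1).1 p1.
have im1 : (f \o inl) @: setT = up a.
  apply: closed_up ra _ => c v /imsetP[x _ ->] /=.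
  have [[y|y] ->] := fS c; last by rewrite (emb_arr fP).
  by move=> _; apply/imsetP; exists y.
exists a; split=> //.
  apply/eqP => ar; have [t2 _] := path_rooted p2.
  have : f (inr t2) \in (f \o inl) @: setT by rewrite im1 ar up_root.
  by case/imsetP=> x _ /(emb_inj fP).
rewrite -im1; apply/setP => v; rewrite in_setC; apply/imsetP/negP.
  by case=> x _ -> /imsetP[y _ /(emb_inj fP)].
have [[y|y] ->] := fS v; last by exists y.
by case; apply/imsetP; exists y.
Qed.

End Product.
End Cuts.

(* [a] stands for its outgoing arrow, whose removal splits [P] into the two
   factors [up P a] and its complement. *)
Definition cuts (N : finType) (P : pth V N) r : {set N} :=
  [set a | [&& a != r, no_stable (src P (up P a) :|: bt (plab P a)),
     no_stable (src P (~: up P a) :|: bt (plab P r)),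
     wt P (up P a) == 1%R & wt P (~: up P a) == 1%R]].

Section ProductCoefficient.
Variables (n : nat) (rho : CP V n) (r : 'I_n).
Local Notation P := (cp2p rho).
Hypothesis rP : rooted P setT r.

Lemma coef_DD_cuts : coef_DD E rho = odd #|cuts P r|.
Proof.
have cI (A : {set 'I_n}) : #|A| < n.+1.
  by rewrite ltnS -[X in _ <= X]card_ord max_card.
rewrite -(@sum_card_fibers _ _ n.+1 (fun a => #|up P a|) (fun a => #|~: up P a|)) //.
congr odd; apply: eq_bigr => k _; apply: eq_bigr => l _.
pose R (x : CP V k * CP V l) a := exists f1 f2,
  [/\ emb (cp2p x.1) P f1, emb (cp2p x.2) P f2, f1 @: setT = up P a
    & f2 @: setT = ~: up P a].
apply: (eq_card_rel (R := R)).
- case=> c d; rewrite inE /= => /and4P[iD1 iD2 _ /pisoP[f fP fT]].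
  have [/and3P[/andP[_ p1] _ _] /and3P[/andP[_ p2] _ _]] := (iD1, iD2).
  have [a [ar fP1 fP2 im1 im2]] := pmul_cut rP p1 p2 fP fT.
  exists a; last by exists (f \o inl), (f \o inr).
  have r1 : rooted P ((f \o inl) @: setT) a by rewrite im1; apply: rooted_up rP.
  have r2 : rooted P ((f \o inr) @: setT) r by rewrite im2; apply: rooted_down.
  move: iD1 iD2; rewrite (emb_inD fP1 r1) (emb_inD fP2 r2) im1 im2.
  case/and3P=> _ g1 w1 /and3P[_ g2 w2]; rewrite !inE ar g1 g2 w1 w2 /=.
  by rewrite -im2 -im1 (emb_card fP1) (emb_card fP2) !card_ord !eqxx.
- move=> a; rewrite !inE => /andP[/and5P[ar g1 g2 w1 w2] /andP[/eqP c1 /eqP c2]].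
  have [c [cc [f1 fP1 im1]]] := canon_ex P c1.
  have [d [cd [f2 fP2 im2]]] := canon_ex P c2.
  have [mul [fP fT]] := cut_pmul rP ar fP1 fP2 im1 im2.
  exists (c, d); last by exists f1, f2.
  rewrite inE /= mul; apply/and4P; split=> //.
  + by rewrite (emb_inD (t := a) fP1) im1 ?cc ?g1 //; apply: rooted_up rP.
  + by rewrite (emb_inD (t := r) fP2) im2 ?cd ?g2 //; apply: rooted_down.
  + by apply/pisoP; eexists; first exact: fP.
(* Two cuts related to one pair give two embeddings of its product, which agree by rigidity. *)
- case=> c d a b _; rewrite !inE => /andP[/andP[ar _] _] /andP[/andP[br _] _].
  case=> f1 [f2 [fP1 fP2 im1 im2]] [g1 [g2 [gP1 gP2 jm1 jm2]]].
  have [_ [fP fT]] := cut_pmul rP ar fP1 fP2 im1 im2.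
  have [_ [gP gT]] := cut_pmul rP br gP1 gP2 jm1 jm2.
  have efg := emb_rigid fP gP (etrans fT (esym gT)).
  rewrite fT in efg; apply: (up_inj rP); rewrite -im1 -jm1.
  by apply: eq_imset => x; apply: (efg _ rP (inl x)).
(* For a given cut the factors embed onto the same node sets, so they are isomorphic and, being
   canonical, equal. *)
- case=> c d [c' d'] a /= ; rewrite !inE /=.
  move=> /and4P[/and3P[/andP[cc _] _ _] /and3P[/andP[cd _] _ _] _ _].
  move=> /and4P[/and3P[/andP[cc' _] _ _] /and3P[/andP[cd' _] _ _] _ _] _.
  case=> f1 [f2 [/= fP1 fP2 im1 im2]] [g1 [g2 [/= gP1 gP2 jm1 jm2]]].
  have [h1 [h1P h1T _]] := emb_inv fP1 gP1 (etrans im1 (esym jm1)).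
  have [h2 [h2P h2T _]] := emb_inv fP2 gP2 (etrans im2 (esym jm2)).
  congr (_, _); apply: canon_eq => //; apply/pisoP.
  + by exists h1.
  + by exists h2.
Qed.

End ProductCoefficient.

(** * Contractions and refinements *)

Section Contraction.
Variables (N : finType) (P : pth V N) (r : N).
Hypothesis rP : rooted P setT r.
Let inT := @in_setT N.

Definition merged (S : {set N}) t mu : bedge V := (mu, src P S, bt (plab P t)).

(* [S] is shrunk to its root [t]; only the nodes outside [S :\ t] are
   meaningful. *)
Definition contract (S : {set N}) t mu : pth V N :=
  Pth (fun v => if v == t then merged S t mu else plab P v)
      (fun a b => if b == t then (a \notin S) && [exists s in S, parr P a s]
                  else parr P a b).

Section Fixed.
Variables (S : {set N}) (t : N) (mu : bool).
Hypothesis rS : rooted P S t.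
Local Notation C := (contract S t mu).
Local Notation M := (~: (S :\ t)).

(** The quotient map of the contraction; its fixed points are the kept nodes. *)
Let rep s := if s \in S then t else s.

Lemma keepE v : (v \in M) = (v \notin S) || (v == t).
Proof. by rewrite !inE negb_and negbK orbC. Qed.

Let tM : t \in M. Proof. by rewrite keepE eqxx orbT. Qed.

Let repM s : rep s \in M.
Proof. by rewrite /rep; case: ifP => [|sS]; rewrite ?tM // keepE sS. Qed.

Lemma exit_notin a s : a \in M -> s \in S -> parr P a s -> a \notin S.
Proof.
rewrite keepE => /orP[// | /eqP->] sS ts.
by move: (rt_top rS sS); rewrite ts.
Qed.

Lemma contract_arr a b : a \in M -> b \in M ->
  reflect (exists2 s, parr P a s & rep s = b) (parr C a b).
Proof.
move=> aM bM /=; have [-> | bt] := eqVneq b t.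
  apply: (iffP andP) => [[aS /exists_inP[s sS as_]] | [s as_]].
    by exists s; rewrite // /rep sS.
  rewrite /rep; case: ifPn => [sS _ | sS est].
    by split; [exact: exit_notin as_ | apply/exists_inP; exists s].
  by move: sS; rewrite est (rt_in rS).
apply: (iffP idP) => [ab | [s as_]].
  exists b; rewrite // /rep; case: ifPn => // bS.
  by move: bM; rewrite keepE bS (negPf bt).
by rewrite /rep; case: ifPn => [_ e | _ <-//]; rewrite e eqxx in bt.
Qed.

Lemma contract_bt v : bt (plab C v) = bt (plab P v).
Proof. by rewrite /=; case: eqP => // ->. Qed.

(** Labels of arrows into [s] are distinct, so no child of [s] inside [S] uses up the vertex coming
    from [a]. *)
Lemma entry_ssrc a s z : a \notin S -> s \in S -> parr P a s ->
  z \in bt (plab P a) -> z \in ssrc P S s.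
Proof.
move=> aS sS as_ za; apply/(ssrcP _ rS sS); split.
  by have /subsetP := rt_sub rP (inT a) (inT s) as_; apply.
move=> b bS bs_; apply: contra aS => zb.
suff -> : a = b by [].
apply: (rt_inj rP (inT a) (inT b) (inT s)) => //.
have [y ey] := rt_bt rP (inT a); have [y' ey'] := rt_bt rP (inT b).
by move: za zb; rewrite ey ey' !inE => /eqP-> /eqP->.
Qed.

Lemma subtree_root : r \in S -> t = r.
Proof.
move=> rIn; apply/eqP/negPn/negP => tr.
have [|b _ rb] := rt_par rS rIn; first by rewrite eq_sym.
by move: (rt_top rP (inT b)); rewrite rb.
Qed.

Let rM : r \in M.
Proof.
rewrite keepE; have [rIn|//] := boolP (r \in S).
by rewrite (subtree_root rIn) eqxx orbT.
Qed.

(** Most properties pass along [rep]. Distinctness of the labels at the merged node, where arrows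
    may enter [S] at different nodes, rests on the disjointness of sources in [rooted_composite]. *)
Lemma contract_rooted : bedge_valid E (merged S t mu) -> rooted C M r.
Proof.
move=> val; split.
- exact: rM.
- by move=> v _ /=; case: ifP => // _; apply: (rt_valid rP).
- move=> a b aM bM ab; rewrite contract_bt.
  case/(contract_arr aM bM): ab => s as_ <-; rewrite /rep /=.
  case: (boolP (s \in S)) => sS.
    rewrite eqxx /=; apply/subsetP => z za; apply/bigcupP; exists s => //.
    exact: entry_ssrc (exit_notin aM sS as_) sS as_ za.
  case: eqP => [st|_]; first by move: sS; rewrite st (rt_in rS).
  exact: (rt_sub rP).
- move=> a b c aM bM cM /(contract_arr aM bM)[s as_ <-].
  case/(contract_arr aM cM)=> s' as' <-.
  by rewrite (rt_fun rP (inT a) (inT s) (inT s') as_ as').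
- move=> a b c aM bM cM /(contract_arr aM cM)[s as_ sc].
  case/(contract_arr bM cM)=> s' bs' sc'; rewrite !contract_bt => e.
  have [es | ns] := eqVneq s s'.
    by subst s'; apply: (rt_inj rP (inT a) (inT b) (inT s)).
  move: sc sc' ns; rewrite /rep.
  case: ifPn => sS; case: ifPn => s'S.
  + move=> _ _ /eqP[]; have [z ez] := rt_bt rP (inT a).
    have za : z \in ssrc P S s.
      by apply: (entry_ssrc (exit_notin aM sS as_)) => //; rewrite ez set11.
    have zb : z \in ssrc P S s'.
      by apply: (entry_ssrc (exit_notin bM s'S bs')) => //; rewrite -e ez set11.
    by have [_ /(_ s s' z z)[]] := rooted_composite rS.
  + by move=> <- e'; rewrite e' (rt_in rS) in s'S.
  + by move=> e' tc; rewrite e' -tc (rt_in rS) in sS.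
  + by move=> -> ->; rewrite eqxx.
- move=> b bM; apply/negP => /(contract_arr rM bM)[s rs _].
  by move: (rt_top rP (inT s)); rewrite rs.
- move=> a aM ar; have [s _ as_] := rt_par rP (inT a) ar.
  by exists (rep s) => //; apply/contract_arr => //; exists s.
(* Induction runs over all nodes of [P] with the predicate pulled back along [rep]; a node of [S]
   other than [t] inherits the claim from its parent in [S], which has the same image. *)
- move=> Q H; suff QR v : Q (rep v).
    move=> v vM; have -> : v = rep v; last by [].
    by move: vM; rewrite keepE /rep; case: ifP => //= _ /eqP.
  move: v (inT v); apply: (rt_ind rP (Q := fun v => Q (rep v))) => v _ IH.
  rewrite /rep; case: ifPn => [vS | vS].
    have [vt | vt] := eqVneq v t.
      subst v; apply: H => // w wM /(contract_arr tM wM)[s ts <-].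
      exact: IH.
    have [w wS vw] := rt_par rS vS vt.
    by move: (IH w (inT w) vw); rewrite /rep wS.
  have vM : v \in M by rewrite keepE vS.
  by apply: H => // w wM /(contract_arr vM wM)[s vs <-]; apply: IH.
Qed.

Lemma contract_src : bedge_valid E (merged S t mu) -> src C M = src P setT.
Proof.
move=> val; have rC := contract_rooted val.
apply/setP => z; apply/bigcupP/bigcupP => -[v].
  move=> vM /(ssrcP _ rC vM)[zv H]; move: zv => /=.
  have [evt | vt] := eqVneq v t.
    subst v => /bigcupP[s sS zs]; exists s => //.
    case/(ssrcP _ rS sS): (zs) => zbs H'.
    apply/(ssrcP _ rP (inT s)); split=> // a _ as_.
    have [aS | aS] := boolP (a \in S); first exact: H'.
    have aM : a \in M by rewrite keepE aS.
    rewrite -(contract_bt a); apply: (H a aM).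
    by apply/(contract_arr aM tM); exists s; rewrite // /rep sS.
  move=> zv; exists v => //.
  have vS : v \notin S by move: vM; rewrite keepE (negPf vt) orbF.
  apply/(ssrcP _ rP (inT v)); split=> // a _ av.
  have aM : a \in M.
    rewrite keepE; have [aS /= | //] := boolP (a \in S).
    apply: contraNT vS => at'; have [w wS aw] := rt_par rS aS at'.
    by rewrite (rt_fun rP (inT a) (inT v) (inT w) av aw).
  rewrite -(contract_bt a); apply: (H a aM).
  by apply/(contract_arr aM vM); exists v; rewrite // /rep (negPf vS).
move=> _ /(ssrcP _ rP (inT v))[zv H]; have [vS | vS] := boolP (v \in S).
  have zS : z \in ssrc P S v by apply/(ssrcP _ rS vS); split=> // a aS; apply: H.
  exists t => //; apply/(ssrcP _ rC tM); split.
    by rewrite /= eqxx; apply/bigcupP; exists v.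
  move=> a aM at'; rewrite contract_bt; apply/negP => za.
  move: at' => /=; rewrite eqxx => /andP[aS /exists_inP[s sS as_]].
  have zs := entry_ssrc aS sS as_ za.
  have [_ /(_ s v z z)[] // _ sv] := rooted_composite rS.
  by subst s; move: (H a (inT a) as_); rewrite za.
have vM : v \in M by rewrite keepE vS.
have vt : v == t = false by apply: contraNF vS => /eqP->; apply: (rt_in rS).
exists v => //; apply/(ssrcP _ rC vM); split; first by rewrite /= vt.
move=> a aM /=; rewrite vt => av; move: (H a (inT a) av).
by case: eqP => // ->.
Qed.

Lemma contract_wt : wt C M = (wt P setT - wt P S + bweight (merged S t mu))%R.
Proof.
have -> : wt P setT = (wt P S + \sum_(v | v \notin S) bweight (plab P v))%R.
  rewrite /wt (bigID [in S]) /=; congr (_ + _)%R; apply: eq_bigl => v;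
  by rewrite inE.
rewrite [X in (X - _)%R]GRing.addrC GRing.addrK GRing.addrC.
rewrite /wt (bigD1 t) //= eqxx; congr (_ + _)%R; apply: eq_big => [v|v].
  rewrite keepE; have [->|vt] := eqVneq v t; first by rewrite (rt_in rS).
  by rewrite orbF andbT.
by case/andP=> _ /negPf->.
Qed.

End Fixed.

(** Decidable form of [rooted]: inside a rooted [P], the parent condition is enough by [rt_sup]. *)
Definition subtree (S : {set N}) t :=
  (t \in S) && [forall v in S :\ t, [exists w in S, parr P v w]].

Lemma subtreeP S t : reflect (rooted P S t) (subtree S t).
Proof.
apply: (iffP andP) => [[tS /forall_inP H] | rS].
  apply: (rt_sup rP) => // v vS vt.
  have vSt : v \in S :\ t by rewrite !inE vt.
  by have /exists_inP[w wS vw] := H v vSt; exists w.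
split; first exact: (rt_in rS).
apply/forall_inP => v /setD1P[vt vS]; apply/exists_inP.
by have [w wS vw] := rt_par rS vS vt; exists w.
Qed.

(** The vertex [z] joining the two boundary nodes is stable or unstable. It lowers by one the weight
    of the node it enters or of the node it leaves, respectively, and it disappears on merging: the
    two nodes contribute [2 + 2 - 1], the merged one [2], and the remaining corrections agree. *)
Lemma boundary_pair_wt S t : rooted P S t -> #|S| = 2 ->
  (forall v, v \in S -> bmu (plab P v)) ->
  wt P S = (bweight (merged S t true) + 1)%R.
Proof.
move=> rS cS bS; have tS := rt_in rS.
have /cards1P[a ea] : #|S :\ t| == 1 by move: cS; rewrite (cardsD1 t) tS add1n => -[->].
have aSt : a \in S :\ t by rewrite ea set11.
have [at' aS] := setD1P aSt.
have eS : S = [set a; t] by rewrite -(setD1K tS) ea setUC.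
have aT : parr P a t.
  have [w] := rt_par rS aS at'; rewrite eS !inE => /orP[] /eqP-> //.
  by move=> aa; move: (rt_irr rS aS); rewrite aa.
have [z ez] := rt_bt rS aS.
have zt : z \in bs (plab P t).
  by have /subsetP := rt_sub rS aS tS aT; apply; rewrite ez set11.
have nch c : c \in S -> ~~ parr P c a.
  rewrite eS !inE => /orP[] /eqP->; first exact: (rt_irr rS).
  exact: (rt_top rS).
have sa : ssrc P S a = bs (plab P a).
  apply/setP => y; apply/(ssrcP _ rS aS)/idP => [[]|ya] //; split=> // c cS' ca.
  by move: (nch c cS'); rewrite ca.
have st : ssrc P S t = bs (plab P t) :\ z.
  apply/setP => y; apply/(ssrcP _ rS tS)/setD1P.
    by case=> yt /(_ a aS aT); rewrite ez inE.
  case=> yz yt; split=> // c; rewrite eS !inE => /orP[] /eqP->.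
    by rewrite ez inE.
  by move=> tt; move: (rt_irr rS tS); rewrite tt.
have esrc : src P S = bs (plab P a) :|: (bs (plab P t) :\ z).
  rewrite -sa -st; apply/setP => y; apply/bigcupP/setUP.
    by case=> v; rewrite {1}eS !inE => /orP[] /eqP->; [left | right].
  by case=> yS; [exists a | exists t].
have dis : bs (plab P a) :&: (bs (plab P t) :\ z) = set0.
  apply/eqP; rewrite -subset0; apply/subsetP => y /setIP[ya yt].
  have [_ /(_ a t y y)] := rooted_composite rS.
  by rewrite sa st => -[] // _ e; rewrite e eqxx in at'.
have zT : z.2 != TO.
  have /and3P[_ _] := rt_valid rS aS; rewrite (bS a aS) => /forall_inP; apply.
  by rewrite inE ez set11 orbT.
rewrite /wt (bigD1 t) //= (bigD1 a) ?aS //= big1; last first.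
  by move=> v; rewrite eS !inE; case: (v == t); case: (v == a).
rewrite GRing.addr0 /bweight !bS //= /bs /bt /= -!/(bs _) -!/(bt _) esrc.
pose cs (X : {set bvert V}) := #|[set x in X | x.2 == TS]|.
pose cu (X : {set bvert V}) := #|[set x in X | x.2 == TU]|.
rewrite -!/(cs _) -!/(cu _).
have -> : cs (bs (plab P t)) = cs (bs (plab P t) :\ z) + (z.2 == TS).
  rewrite /cs (cardsD1 z) inE zt /= addnC; congr (#|pred_of_set _| + _).
  by apply/setP => y; rewrite !inE andbA.
have -> : cs (bs (plab P a) :|: bs (plab P t) :\ z) =
    cs (bs (plab P a)) + cs (bs (plab P t) :\ z).
  rewrite /cs -cardsUI [X in _ = _ + X]eq_card0 ?addn0; last first.
    move=> y; rewrite !inE -!andbA; apply/negP => /and5P[ya _ yz yt _].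
    by have : y \in set0; [rewrite -dis !inE ya yz yt | rewrite inE].
  by congr #|pred_of_set _|; apply/setP => y; rewrite !inE andb_orl.
have -> : cu (bt (plab P a)) = (z.2 == TU).
  rewrite /cu ez; case: (boolP (z.2 == TU)) => zu.
    rewrite (_ : [set _ in _ | _] = [set z]) ?cards1 //.
    by apply/setP => y; rewrite !inE; case: eqP => // ->.
  rewrite (_ : [set _ in _ | _] = set0) ?cards0 //.
  apply/setP => y; rewrite !inE; case: eqP => // ->; exact: negPf zu.
by case: (z.2) zT => [|_|_]; rewrite ?eqxx ?vtype_eqE //=; lia.
Qed.

End Contraction.

(** * Refinement as the inverse of contraction *)

Section Refinement.
Variables (N : finType) (P : pth V N) (r : N).
Hypothesis rP : rooted P setT r.
Let inT := @in_setT N.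
Variables (M0 M1 : finType) (Q0 : pth V M0) (Q1 : pth V M1) (v : M0).

Definition glue (f0 : M0 -> N) (f1 : M1 -> N) (x : rnode v M1) : N :=
  match x with inl y => f0 (val y) | inr y => f1 y end.

(** An arrow into the merged node is reattached to the node of [S] sourcing its label, unique by
    [rooted_composite]; an arrow out of it is reattached to the root [t], which carries the target.
    So refining undoes the contraction. *)
Lemma contract_refine S t mu f0 f1 : rooted P S t ->
  emb Q0 (contract P S t mu) f0 -> f0 @: setT = ~: (S :\ t) -> f0 v = t ->
  emb Q1 P f1 -> f1 @: setT = S ->
  [/\ refinable Q0 v Q1, emb (refine Q0 v Q1) P (glue f0 f1)
    & glue f0 f1 @: setT = setT].
Proof.
move=> rS fP0 im0 f0v fP1 im1.
have r1 : rooted P (f1 @: setT) t by rewrite im1.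
have /imsetP[t1 _ tt1] := rt_in r1.
have r1' : rooted Q1 setT t1 by apply/(emb_rooted fP1); rewrite -tt1.
have lab0 x : plab Q0 x = if f0 x == t then merged P S t mu else plab P (f0 x).
  by rewrite -(emb_lab fP0).
have labv : plab Q0 v = merged P S t mu by rewrite lab0 f0v eqxx.
have M0E x : f0 x \in ~: (S :\ t) by rewrite -im0 imset_f.
have nt x : x != v -> f0 x != t by rewrite -f0v (inj_eq (emb_inj fP0)).
have nS x : x != v -> f0 x \notin S.
  by move/nt => xt; have := M0E x; rewrite keepE (negPf xt) orbF.
have in1 y : f1 y \in S by rewrite -im1 imset_f.
have lab x : x != v -> plab P (f0 x) = plab Q0 x.
  by move/nt => xt; rewrite lab0 (negPf xt).
have ref : refinable Q0 v Q1.
  by rewrite /refinable labv (emb_psrc fP1) im1 (emb_ptgt fP1 r1) !eqxx.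
split=> //; first split.
- case=> [[x xv]|x] [[y yv]|y] /= e.
  + by congr inl; apply: val_inj; apply: (emb_inj fP0).
  + by move: (nS x xv); rewrite e in1.
  + by move: (nS y yv); rewrite -e in1.
  + by rewrite (emb_inj fP1 e).
- by case=> [[x xv]|x] /=; rewrite ?lab // (emb_lab fP1).
- case=> [[x xv]|x] [[y yv]|y] /=.
  + by rewrite -(emb_arr fP0) /= (negPf (nt y yv)).
  + have arr0 : parr Q0 x v = [exists s in S, parr P (f0 x) s].
      by rewrite -(emb_arr fP0) f0v /= eqxx (nS x xv).
    rewrite arr0; apply/idP/andP.
      move=> xy; split; first by apply/exists_inP; exists (f1 y).
      have [z ez] := rt_bt rP (inT (f0 x)).
      have zy : z \in ssrc P S (f1 y).
        by apply: (entry_ssrc rP rS (nS x xv)) => //; rewrite ez set11.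
      apply/existsP; exists z; rewrite (emb_sourced fP1) im1 zy andbT.
      rewrite inE -(lab x xv) ez set11 labv /=.
      by apply/bigcupP; exists (f1 y).
    case=> /exists_inP[s sS xs] /existsP[z /andP[/setIP[zx _]]].
    rewrite (emb_sourced fP1) im1 => zy; rewrite -(lab x xv) in zx.
    have zs := entry_ssrc rP rS (nS x xv) sS xs zx.
    by have [_ /(_ _ _ _ _ sS (in1 y) zs zy)[] // _ <-] := rooted_composite rS.
  + have arr0 : parr Q0 v y = parr P t (f0 y).
      by rewrite -(emb_arr fP0) f0v /= (negPf (nt y yv)).
    have tg z : targeted Q1 z x = (x == t1) && (z \in bt (plab P t)).
      by rewrite (ptgt_rooted r1') -(emb_lab fP1) -tt1.
    rewrite arr0; apply/idP/andP.
      move=> xy; have xt : f1 x = t.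
        apply/eqP/negPn/negP => xt; have [w wS xw] := rt_par rS (in1 x) xt.
        move: (nS y yv).
        by rewrite (rt_fun rP (inT (f1 x)) (inT (f0 y)) (inT w) xy xw) wS.
      rewrite xt in xy; split => //; apply/existsP.
      have [z ez] := rt_bt rP (inT t); exists z.
      rewrite tg -(inj_eq (emb_inj fP1)) -tt1 xt ez set11 eqxx !andbT.
      rewrite inE labv /= ez set11 /= -(lab y yv).
      by have /subsetP := rt_sub rP (inT t) (inT (f0 y)) xy; apply; rewrite ez set11.
    by case=> ty /existsP[z /andP[_]]; rewrite tg => /andP[/eqP-> _]; rewrite -tt1.
  + exact: (emb_arr fP1).
- apply/setP => w; rewrite inE; apply/imsetP.
  have [wS | wS] := boolP (w \in S).
    by move: (wS); rewrite -im1 => /imsetP[y _ ->]; exists (inr y).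
  have : w \in f0 @: setT by rewrite im0 keepE wS.
  case/imsetP=> x _ wx; have xv : x != v.
    by apply: contraNneq wS => e; rewrite wx e f0v (rt_in rS).
  by exists (inl (Sub x xv)).
Qed.

(** [S] is the image of the inserted path [Q1], and [f0] identifies [Q0] with the contraction of [S]
    by sending [v] to the root of [S]. *)
Lemma refine_contract f : is_path Q0 E -> is_path Q1 E -> refinable Q0 v Q1 ->
  emb (refine Q0 v Q1) P f -> f @: setT = setT ->
  exists S t f0, [/\ rooted P S t, bedge_valid E (merged P S t (bmu (plab Q0 v))),
    emb Q0 (contract P S t (bmu (plab Q0 v))) f0 /\ f0 @: setT = ~: (S :\ t),
    f0 v = t & emb Q1 P (f \o inr) /\ (f \o inr) @: setT = S].
Proof.
move=> p0 p1 /andP[/eqP rs /eqP rt] fP fT.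
have [r0 r0P] := path_rooted p0; have [t1 t1P] := path_rooted p1.
have inT0 := @in_setT M0.
have fP1 : emb Q1 P (f \o inr).
  split=> [x y /(emb_inj fP) []|x|x y] //=; first by rewrite (emb_lab fP).
  by rewrite (emb_arr fP).
set S := (f \o inr) @: setT; set t := f (inr t1).
have rS : rooted P S t by apply/(emb_rooted fP1).
have fS w : exists x, w = f x.
  by have : w \in f @: setT by [rewrite fT inE]; case/imsetP=> x _ ->; exists x.
have inS y : f (inr y) \in S by apply/imsetP; exists y.
have inlS u : f (inl u) \notin S.
  by apply/imsetP => -[y _ /(emb_inj fP)].
have labv : plab Q0 v = merged P S t (bmu (plab Q0 v)).
  rewrite /merged -(emb_psrc fP1) rs -(emb_ptgt fP1 rS) rt.
  by case: (plab Q0 v) => [[]].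
(* [insub x] fails exactly at [x = v], where the default [t] is the wanted value. *)
pose f0 x : N := if insub x is Some u then f (inl u) else t.
have f0v : f0 v = t by rewrite /f0 insubF // eqxx.
have f0n x (xv : x != v) : f0 x = f (inl (Sub x xv)).
  by rewrite /f0 insubT.
have f0t x : x != v -> f0 x != t.
  by move=> xv; rewrite f0n; apply: contraNneq (inlS (Sub x xv)) => ->; apply: inS.
exists S, t, f0; split=> //.
- by rewrite -labv; apply: (rt_valid r0P).
- split; last first.
    apply/setP => w; rewrite keepE; apply/imsetP/orP.
      case=> x _ ->; have [-> | xv] := eqVneq x v; first by right; rewrite f0v.
      by left; rewrite f0n.
    case=> [wS | /eqP->]; last by exists v.
    have [[[x xv]|y] wx] := fS w; last by move: wS; rewrite wx inS.
    by exists x; rewrite // f0n wx; congr (f (inl _)); apply: val_inj.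
  split.
  + move=> x y; have [-> | xv] := eqVneq x v; have [-> | yv] := eqVneq y v => //.
    * by rewrite f0v => /esym/eqP; rewrite (negPf (f0t y yv)).
    * by rewrite f0v => /eqP; rewrite (negPf (f0t x xv)).
    * by rewrite !f0n => /(emb_inj fP)[].
  + move=> x /=; have [-> | xv] := eqVneq x v; first by rewrite f0v eqxx.
    by rewrite (negPf (f0t x xv)) f0n (emb_lab fP).
  + move=> x y /=; have [-> | xv] := eqVneq x v; have [-> | yv] := eqVneq y v.
    * rewrite f0v eqxx (rt_in rS) /=; apply/esym/negbTE.
      exact: (rt_irr r0P).
    * rewrite f0v (negPf (f0t y yv)) f0n (emb_arr fP) /=.
      apply/andP/idP => [[] // | vy]; split=> //; apply/existsP.
      have [z ez] := rt_bt r0P (inT0 v); exists z.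
      rewrite (ptgt_rooted t1P) eqxx -(ptgt_root t1P) rt /alab inE ez set11 /=.
      rewrite andbT.
      by have /subsetP := rt_sub r0P (inT0 v) (inT0 y) vy; apply; rewrite ez set11.
    * rewrite f0v eqxx f0n inlS /=; apply/exists_inP/idP.
        by case=> _ /imsetP[k _ ->]; rewrite (emb_arr fP) /= => /andP[].
      move=> xv0; have [z ez] := rt_bt r0P (inT0 x).
      have zv : z \in bs (plab Q0 v).
        have /subsetP := rt_sub r0P (inT0 x) (inT0 v) xv0.
        by apply; rewrite ez set11.
      move: (zv); rewrite -rs => /bigcupP[k _ zk].
      exists (f (inr k)) => //; rewrite (emb_arr fP) /= xv0 /=.
      by apply/existsP; exists z; rewrite inE ez set11 zv.
    * by rewrite (negPf (f0t y yv)) !f0n (emb_arr fP).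
Qed.

End Refinement.

(* [(t, S, mu)] stands for the term of the differential in which a node of
   label [merged P S t mu] was replaced by the subtree [S] of root [t]. *)
Definition blocks (N : finType) (P : pth V N) r : {set N * {set N} * bool} :=
  [set y | let: (t, T, mu) := y in
    [&& subtree P T t, no_stable (src P setT :|: bt (plab P r)),
      wt P setT == 2%R, bedge_valid E (merged P T t mu) &
      if mu then [forall v in T, bmu (plab P v)] && (#|T| == 2)
      else wt P T == 2%R]].

Section DifferentialCoefficient.
Variables (n : nat) (rho : CP V n) (r : 'I_n).
Local Notation P := (cp2p rho).
Hypothesis rP : rooted P setT r.

Lemma emb_boundary k (c : CP V k) f : emb (cp2p c) P f ->
  pboundary (cp2p c) = [forall v in f @: setT, bmu (plab P v)].
Proof.
move=> fP; apply/forallP/forall_inP => [H _ /imsetP[x _ ->] | H x].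
  by rewrite (emb_lab fP).
by rewrite -(emb_lab fP); apply: H; rewrite imset_f.
Qed.

(** Contracting lowers the weight by one in both cases: an interior block of weight 2 becomes an
    edge of weight 1, and a boundary pair is covered by [boundary_pair_wt]. *)
Lemma block_wt S t (mu : bool) : rooted P S t ->
  (if mu then [forall v in S, bmu (plab P v)] && (#|S| == 2) else wt P S == 2%R) ->
  (wt (contract P S t mu) (~: (S :\ t)) == 1%R) = (wt P setT == 2%R).
Proof.
move=> rS; rewrite (contract_wt _ rS); case: mu.
  case/andP=> /forall_inP bS /eqP cS; rewrite (boundary_pair_wt rS cS bS); lia.
by move/eqP=> ->; rewrite /bweight /=; lia.
Qed.

(** Contraction preserves source and target, so [c0] is good exactly when [P] is, and [block_wt]
    translates the weights. *)
Lemma coef_dD_blocks : coef_dD E rho = odd #|blocks P r|.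
Proof.
have cI (A : {set 'I_n}) : #|A| < n.+1.
  by rewrite ltnS -[X in _ <= X]card_ord max_card.
rewrite -(@sum_card_fibers _ _ n.+1 (fun y => #|~: (y.1.2 :\ y.1.1)|)
  (fun y => #|y.1.2|)) //.
congr odd; apply: eq_bigr => k _; apply: eq_bigr => l _.
pose R (x : CP V k * 'I_k * CP V l) (y : 'I_n * {set 'I_n} * bool) :=
  let: (c0, v, c1) := x in let: (t, T, mu) := y in exists f0 f1,
  [/\ emb (cp2p c0) (contract P T t mu) f0 /\ f0 @: setT = ~: (T :\ t),
    f0 v = t & emb (cp2p c1) P f1 /\ f1 @: setT = T].
apply: (eq_card_rel (R := R)).
- case=> [[c0 v] c1]; rewrite inE /= => /and5P[iD0 /andP[_ p1] cond ref].
  case/pisoP=> f fP fT; have /and3P[/andP[_ p0] _ _] := iD0.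
  have [S [t [f0 [rS val [fP0 im0] f0v [fP1 im1]]]]] :=
    refine_contract p0 p1 ref fP fT.
  set mu := bmu _ in val fP0; exists (t, S, mu); last by exists f0, (f \o inr).
  have rC : rooted (contract P S t mu) (f0 @: setT) r.
    by rewrite im0; apply: contract_rooted.
  have rS1 : rooted P ((f \o inr) @: setT) t by rewrite im1.
  have cond' : if mu then [forall v in S, bmu (plab P v)] && (#|S| == 2)
               else wt P S == 2%R.
    move: cond; rewrite -/mu; case: (mu).
      by rewrite (emb_boundary fP1) im1 /plength -im1 (emb_card fP1).
    by rewrite (emb_pweight fP1) im1.
  move: iD0; rewrite (emb_inD fP0 rC) im0 (contract_src rP rS val) contract_bt.
  rewrite (block_wt rS cond') => /and3P[_ g w].
  have st : subtree P S t by apply/(subtreeP rP).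
  rewrite !inE st g w val cond' /= -im0 -im1 (emb_card fP0) (emb_card fP1).
  by rewrite !card_ord !eqxx.
- case=> [[t S] mu]; rewrite !inE /= => /andP[].
  case/and5P=> /(subtreeP rP) rS g w val cond /andP[/eqP ck /eqP cl].
  have [c0 [cc0 [f0 fP0 im0]]] := canon_ex (contract P S t mu) ck.
  have [c1 [cc1 [f1 fP1 im1]]] := canon_ex P cl.
  have rC : rooted (contract P S t mu) (f0 @: setT) r.
    by rewrite im0; apply: contract_rooted.
  have rS1 : rooted P (f1 @: setT) t by rewrite im1.
  have /imsetP[v _ tv] : t \in f0 @: setT by rewrite im0 keepE eqxx orbT.
  have [ref fP fT] := contract_refine rP rS fP0 im0 (esym tv) fP1 im1.
  exists (c0, v, c1); last by exists f0, f1.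
  rewrite inE; apply/and5P; split=> //.
  + rewrite (emb_inD fP0 rC) im0 (contract_src rP rS val) contract_bt cc0 g.
    by rewrite (block_wt rS cond).
  + by rewrite /basis cc1; apply/(emb_pathP fP1); exists t.
  + have -> : bmu (plab (cp2p c0) v) = mu.
      by rewrite -(emb_lab fP0) -tv /= eqxx.
    move: cond; case: (mu).
      by rewrite (emb_boundary fP1) im1 /plength -im1 (emb_card fP1).
    by rewrite (emb_pweight fP1) im1.
  + by apply/pisoP; exists (glue f0 f1).
- case=> [[c0 v] c1] [[t S] mu] [[t' S'] mu'] _; rewrite !inE /=.
  case/andP=> /and5P[/(subtreeP rP) rS _ _ _ _] _.
  case/andP=> /and5P[/(subtreeP rP) rS' _ _ _ _] _.
  case=> f0 [f1 [[fP0 im0] f0v [fP1 im1]]].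
  case=> g0 [g1 [[gP0 jm0] g0v [gP1 jm1]]].
  have [_ fP fT] := contract_refine rP rS fP0 im0 f0v fP1 im1.
  have [_ gP gT] := contract_refine rP rS' gP0 jm0 g0v gP1 jm1.
  have := emb_rigid fP gP (etrans fT (esym gT)); rewrite fT => /(_ _ rP) efg.
  have eS : S = S'.
    by rewrite -im1 -jm1; apply: eq_imset => x; apply: (efg (inr x)).
  rewrite -eS in rS'; rewrite (rt_uniq rS rS') -eS; congr (_, _, _).
  have : bmu (plab (cp2p c0) v) = mu by rewrite -(emb_lab fP0) f0v /= eqxx.
  by move=> <-; rewrite -(emb_lab gP0) g0v /= eqxx.
- case=> [[c0 v] c1] [[d0 w] d1] [[t S] mu]; rewrite !inE /=.
  case/and5P=> /and3P[/andP[cc0 _] _ _] /andP[cc1 _] _ _ _.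
  case/and5P=> /and3P[/andP[cd0 _] _ _] /andP[cd1 _] _ _ _.
  case/andP=> /and5P[/(subtreeP rP) rS _ _ val _] _.
  case=> f0 [f1 [[fP0 im0] f0v [fP1 im1]]].
  case=> g0 [g1 [[gP0 jm0] g0v [gP1 jm1]]].
  have [h0 [h0P h0T _]] := emb_inv fP0 gP0 (etrans im0 (esym jm0)).
  have [h1 [h1P h1T _]] := emb_inv fP1 gP1 (etrans im1 (esym jm1)).
  have e0 : c0 = d0 by apply: canon_eq => //; apply/pisoP; exists h0.
  have e1 : c1 = d1 by apply: canon_eq => //; apply/pisoP; exists h1.
  subst d0 d1; congr (_, _, _); apply: (emb_inj gP0); rewrite g0v -f0v.
  apply/esym; apply: (emb_rigid fP0 gP0 (etrans im0 (esym jm0)) (t := r)).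
  by rewrite im0; apply: contract_rooted.
Qed.

End DifferentialCoefficient.

(** * Good paths of weight 2 *)

Section Parity.
Variables (N : finType) (P : pth V N) (r : N).
Hypothesis rP : rooted P setT r.
Let inT := @in_setT N.

Let rbt v : exists z, bt (plab P v) = [set z] := rt_bt rP (inT v).
Let rfun a b c : parr P a b -> parr P a c -> b = c :=
  rt_fun rP (inT a) (inT b) (inT c).

Lemma src_sub S t z : rooted P S t -> z \in src P S ->
  z \in src P setT \/
  exists c v, [/\ c \notin S, v \in S, parr P c v & z \in bt (plab P c)].
Proof.
move=> rS /bigcupP[v vS zv]; case/(ssrcP _ rS vS): (zv) => zb H.
have [/existsP[c /and3P[cS cv zc]]|nex] :=
  boolP [exists c, [&& c \notin S, parr P c v & z \in bt (plab P c)]].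
  by right; exists c, v.
left; apply/bigcupP; exists v => //; apply/(ssrcP _ rP (inT v)); split=> // c _ cv.
have [cS | cS] := boolP (c \in S); first exact: H.
by apply: contra nex => zc; apply/existsP; exists c; rewrite cS cv.
Qed.

Lemma wt_setC (S : {set N}) : wt P setT = (wt P S + wt P (~: S))%R.
Proof.
rewrite /wt (bigID [in S]) /=; congr (_ + _)%R; apply: eq_bigl => v;
by rewrite !inE.
Qed.

(** Membership in [E] and injectivity on the source come from [rooted_composite], which leaves the
    conditions on types. *)
Lemma merged_valid S t (mu : bool) : rooted P S t ->
  bedge_valid E (merged P S t mu) =
  if mu then [forall z in src P S :|: bt (plab P t), z.2 != TO]
  else [forall z in src P S, z.2 != TS] && [forall z in bt (plab P t), z.2 != TU].
Proof.
move=> rS; have [eE inj] := rooted_composite rS.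
rewrite /bedge_valid /merged {1 2 3 4}/bs {1 2 3 4}/bt /= eE /=.
rewrite (_ : [forall x in _, _] = true); last first.
  apply/forall_inP => y /bigcupP[v vS yv]; apply/forall_inP => z /bigcupP[w wS zw].
  by apply/implyP => /eqP e; have [-> _] := inj v w y z vS wS yv zw e.
rewrite (_ : [forall x in _, _] = true) //.
have [u eu] := rbt t.
apply/forall_inP => y yt; apply/forall_inP => z; move: yt.
by rewrite -/(bt _) eu !inE => /eqP-> /eqP->; rewrite !eqxx.
Qed.

Lemma no_stableU (X Y : {set bvert V}) :
  no_stable (X :|: Y) = no_stable X && no_stable Y.
Proof.
apply/forall_inP/andP => [H | [/forall_inP HX /forall_inP HY] z].
  by split; apply/forall_inP => z zX; apply: H; rewrite inE zX ?orbT.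
by case/setUP; [apply: HX | apply: HY].
Qed.

Lemma cuts_good a : a \in cuts P r ->
  no_stable (src P setT :|: bt (plab P r)) /\ wt P setT = 2%R.
Proof.
rewrite inE => /and5P[ar g1 g2 /eqP w1 /eqP w2].
split; last by rewrite (wt_setC (up P a)) w1 w2.
move: g1 g2; rewrite !no_stableU => /andP[/forall_inP g1 _] /andP[/forall_inP g2 ->].
rewrite andbT; apply/forall_inP => z /bigcupP[v _ /(ssrcP _ rP (inT v))[zv H]].
have [va | va] := boolP (v \in up P a).
  apply: g1; apply/bigcupP; exists v => //.
  by apply/(ssrcP _ (rooted_up a rP) va); split=> // b _; apply: H.
have va' : v \in ~: up P a by rewrite inE.
apply: g2; apply/bigcupP; exists v => //.
by apply/(ssrcP _ (rooted_down rP ar) va'); split=> // b _; apply: H.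
Qed.

Definition out_type v : vtype :=
  if [pick z in bt (plab P v)] is Some z then z.2 else TO.
Local Notation sg := out_type.

Lemma out_typeP v z : z \in bt (plab P v) -> z.2 = sg v.
Proof.
have [y ey] := rbt v; rewrite /sg; case: pickP => [w|/(_ y)]; rewrite ey ?set11 //.
by move=> /set1P-> /set1P->.
Qed.

Lemma interior_out v : ~~ bmu (plab P v) -> sg v != TU.
Proof.
move=> nv; have /and3P[_ _] := rt_valid rP (inT v); rewrite (negPf nv).
case/andP=> _ /forall_inP H; have [z ez] := rbt v.
by rewrite -(@out_typeP _ z) ?H ?ez ?set11.
Qed.

Lemma boundary_out v : bmu (plab P v) -> sg v != TO.
Proof.
move=> bv; have /and3P[_ _] := rt_valid rP (inT v); rewrite bv.
move/forall_inP=> H; have [z ez] := rbt v.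
by rewrite -(@out_typeP _ z) ?H ?inE ?ez ?set11 ?orbT.
Qed.

Lemma stable_arrow a b : parr P a b -> sg a = TS -> bmu (plab P b).
Proof.
move=> ab sa; apply/negPn/negP => nb.
have /and3P[_ _] := rt_valid rP (inT b); rewrite (negPf nb).
case/andP=> /forall_inP H _; have [z ez] := rbt a.
have /subsetP/(_ z) := rt_sub rP (inT a) (inT b) ab.
by rewrite ez set11 => /(_ isT) /H; rewrite (@out_typeP a) ?sa ?eqxx // ez set11.
Qed.

Lemma interior_arrow a b : parr P a b -> sg a = TO -> ~~ bmu (plab P b).
Proof.
move=> ab sa; apply/negP => nb.
have /and3P[_ _] := rt_valid rP (inT b); rewrite nb.
move=> /forall_inP H; have [z ez] := rbt a.
have /subsetP/(_ z) := rt_sub rP (inT a) (inT b) ab.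
rewrite ez set11 => /(_ isT) zb; have := H z; rewrite inE zb => /(_ isT).
by rewrite (@out_typeP a) ?sa ?eqxx // ez set11.
Qed.

Hypothesis good : no_stable (src P setT :|: bt (plab P r)).
Hypothesis wt2 : wt P setT = 2%R.

Let good_src z : z \in src P setT -> z.2 != TS.
Proof. by move=> zs; move/forall_inP: good; apply; rewrite inE zs. Qed.

Lemma root_out : sg r != TS.
Proof.
have [z ez] := rbt r; rewrite -(@out_typeP r z) ?ez ?set11 //.
by move/forall_inP: good; apply; rewrite inE ez set11 orbT.
Qed.

Definition stable_children v := [set c | parr P c v & sg c == TS].

(** A stable source vertex of [v] cannot belong to the source of the good path [P], so a child
    supplies it, and different children supply different vertices. *)
Lemma card_stable_children v :
  #|[set z in bs (plab P v) | z.2 == TS]| = #|stable_children v|.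
Proof.
apply/esym; apply: (eq_card_rel (R := fun c z => bt (plab P c) = [set z])).
- move=> c; rewrite inE => /andP[cv sc]; have [z ez] := rbt c; exists z => //.
  have zc : z \in bt (plab P c) by rewrite ez set11.
  rewrite inE (out_typeP zc) sc andbT.
  by have /subsetP := rt_sub rP (inT c) (inT v) cv; apply.
- move=> z; rewrite inE => /andP[zv zS].
  have [/existsP[c /andP[cv zc]]|nex] :=
    boolP [exists c, parr P c v && (z \in bt (plab P c))].
    exists c; first by rewrite inE cv -(out_typeP zc).
    by have [y ey] := rbt c; move: zc; rewrite ey inE => /eqP->.
  suff /good_src : z \in src P setT by rewrite zS.
  apply/bigcupP; exists v => //; apply/(ssrcP _ rP (inT v)); split=> // c _ cv.
  by apply: contra nex => zc; apply/existsP; exists c; rewrite cv.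
- by move=> c z z' _ _ _ -> /set1_inj.
- move=> c c' z; rewrite !inE => /andP[cv _] /andP[cv' _] _ e e'.
  by apply: (rt_inj rP (inT c) (inT c') (inT v)); rewrite // e e'.
Qed.

Definition excess v : nat := bmu (plab P v) + (sg v == TO).

Lemma excess_le1 v : excess v <= 1.
Proof.
rewrite /excess; case: (boolP (bmu _)) => [/boundary_out/negPf->|] //.
by case: eqP.
Qed.

(** The target of a boundary node is stable or unstable, so [2] minus its unstable count is one plus
    its stable count. An interior node has no stable source vertex, and its weight 1 records a
    target of type [o] or [s]. *)
Lemma bweight_excess v : (bweight (plab P v) + #|stable_children v|%:Z =
  (excess v + (sg v == TS))%:Z)%R.
Proof.
have [z ez] := rbt v; have ze : z.2 = sg v by apply: out_typeP; rewrite ez set11.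
rewrite -card_stable_children /bweight /excess.
case: (boolP (bmu _)) => bv.
  have -> : #|[set y in bt (plab P v) | y.2 == TU]| = (sg v == TU).
    rewrite ez -ze; case: (boolP (z.2 == TU)) => zu.
      rewrite (_ : [set _ in _ | _] = [set z]) ?cards1 //.
      by apply/setP => y; rewrite !inE; case: eqP => // ->.
    rewrite (_ : [set _ in _ | _] = set0) ?cards0 //.
    by apply/setP => y; rewrite !inE; case: eqP => // ->; exact: negPf zu.
  by move: (boundary_out bv); case: (sg v); rewrite ?eqxx ?vtype_eqE //=; lia.
have -> : #|[set y in bs (plab P v) | y.2 == TS]| = 0.
  apply/eqP; rewrite cards_eq0 -subset0; apply/subsetP => y; rewrite !inE.
  have /and3P[_ _] := rt_valid rP (inT v); rewrite (negPf bv) => /andP[/forall_inP H _].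
  by case/andP=> /H/negPf->.
by move: (interior_out bv); case: (sg v); rewrite ?eqxx ?vtype_eqE //=; lia.
Qed.

(* Each stable arrow costs its target one unit of weight, so only the stable
   output of the root of a subtree closed under stable children survives. *)
Lemma wt_excess S t : rooted P S t ->
  (forall c v, v \in S -> parr P c v -> sg c = TS -> c \in S) ->
  wt P S = ((\sum_(v in S) excess v + (sg t == TS))%N)%:Z%R.
Proof.
move=> rS clS.
have e1 : (wt P S + (\sum_(v in S) #|stable_children v|)%N%:Z =
    (\sum_(v in S) excess v + \sum_(v in S) (sg v == TS))%N%:Z)%R.
  rewrite -big_split /= !(big_morph Posz PoszD (erefl _)) -big_split /=.
  by apply: eq_bigr => v _; apply: bweight_excess.
have e2 : \sum_(v in S) (sg v == TS) =
    \sum_(v in S) #|stable_children v| + (sg t == TS).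
  under [in RHS]eq_bigr => v vS.
    rewrite (_ : #|_| = \sum_(c in S) (parr P c v && (sg c == TS))); last first.
      rewrite -sum1_card big_mkcond [RHS]big_mkcond; apply: eq_bigr => c _.
      rewrite inE; case: (boolP (parr P c v)) => cv; case: eqP => sc //=; rewrite ?if_same //.
      by rewrite (clS c v).
    over.
  rewrite exchange_big /= (bigD1 t (rt_in rS)) /= [RHS]addnC; congr (_ + _).
  rewrite [RHS](bigD1 t (rt_in rS)) /= [X in _ = X + _]big1 ?add0n; last first.
    by move=> v vS; rewrite (negPf (rt_top rS vS)).
  apply: eq_bigr => c /andP[cS ct]; have [p pS cp] := rt_par rS cS ct.
  rewrite (bigD1 p pS) /= cp big1 ?addn0 // => q /andP[_ qp].
  by case: (boolP (parr P c q)) => // /(rfun cp) e; rewrite e eqxx in qp.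
move: e1; rewrite e2; lia.
Qed.

Lemma excess_nodes : exists2 x, x != r & forall v, excess v = (v == r) + (v == x).
Proof.
have e : \sum_(v in setT) excess v = 2.
  have := wt_excess rP (fun _ _ _ _ _ => inT _).
  by rewrite wt2 (negPf root_out) addn0 => -[].
(* The target of the root is not stable: it is unstable for a boundary root and of type [o] for an
   interior one. *)
have er : excess r = 1.
  rewrite /excess; case: (boolP (bmu _)) => [/boundary_out/negPf->//|/interior_out].
  by move: root_out; case: (sg r); rewrite ?eqxx.
move: e; rewrite (bigD1 r) //= er add1n => -[e].
have [/existsP[x /andP[xr x0]]|nex] := boolP [exists x, (x != r) && (0 < excess x)];
  last first.
  move: e; rewrite big1 // => v; rewrite inE /= => vr.
  by apply/eqP; rewrite -leqn0 leqNgt; apply: contra nex => v0; apply/existsP;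
     exists v; rewrite vr.
have ex : excess x = 1 by apply/eqP; rewrite eqn_leq excess_le1.
exists x => // v; have [-> | vr] := eqVneq v r.
  by rewrite er eq_sym (negPf xr).
have [-> // | vx] := eqVneq v x.
move: e; rewrite (bigD1 x) /= ?inE // ex => /eqP; rewrite eqSS sum_nat_eq0.
by move/forall_inP/(_ v); rewrite !inE vr vx => /(_ isT) /eqP.
Qed.

(** * Cuts and contractions located by the second node of excess 1 *)

Section ExtraNode.
Variable x : N.
Hypothesis xr : x != r.
Hypothesis excessE : forall v, excess v = (v == r) + (v == x).

Lemma ordinary v : v != r -> v != x -> ~~ bmu (plab P v) /\ sg v = TS.
Proof.
move=> vr vx; have := excessE v; rewrite (negPf vr) (negPf vx) /excess.
case: (boolP (bmu _)) => //= /interior_out.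
by case: (sg v); rewrite ?eqxx.
Qed.

Lemma sum_excess (S : {set N}) : \sum_(v in S) excess v = (r \in S) + (x \in S).
Proof.
under eq_bigr => v _ do rewrite excessE.
have H y : \sum_(v in S) (v == y) = (y \in S).
  have [yS | yS] := boolP (y \in S).
    by rewrite (bigD1 y yS) /= eqxx big1 // => v /andP[_ /negPf->].
  by rewrite big1 // => v vS; case: eqP => // e; rewrite -e vS in yS.
by rewrite big_split /= !H.
Qed.

Let r_up t : (r \in up P t) = (t == r).
Proof.
apply/idP/eqP => [|->]; last by rewrite (up_root rP) inE.
by move=> ru; apply/eqP; apply: contraTT ru => /(root_notin_up rP).
Qed.

Lemma wt_up t : wt P (up P t) =
  (((t == r) + (x \in up P t) + (sg t == TS))%N)%:Z%R.
Proof.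
rewrite (wt_excess (rooted_up t rP)) ?sum_excess ?r_up // => c v vt cv _.
exact: up_closed vt cv.
Qed.

Lemma src_up t : src P (up P t) \subset src P setT.
Proof.
apply/subsetP => z /(src_sub (rooted_up t rP))[//|[c [v [cu vu cv _]]]].
by rewrite (up_closed vu cv) in cu.
Qed.

(** A cut at [a] makes the target vertex of [a] a target of the first factor, so it must not be
    stable, and among the nodes below the root only [x] is left. The full subtree of [x] then has
    weight 1 by [wt_up], and its complement the other unit. *)
Lemma cutsE : cuts P r = if sg x == TS then set0 else [set x].
Proof.
suff H a : (a \in cuts P r) = (a == x) && (sg x != TS).
  by apply/setP => a; rewrite H; case: (sg x == TS); rewrite !inE ?andbF ?andbT.
apply/idP/andP => [|[/eqP-> sx]].
  rewrite inE => /and5P[ar g1 _ _ _].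
  have sa : sg a != TS.
    have [z ez] := rbt a; rewrite -(@out_typeP a z) ?ez ?set11 //.
    by move/forall_inP: g1; apply; rewrite inE ez set11 orbT.
  suff eax : a = x by rewrite -eax sa eqxx.
  by apply/eqP; apply: contraNT sa => ax; have [_ ->] := ordinary ar ax.
have w1 : wt P (up P x) = 1%R.
  by rewrite wt_up (negPf xr) (negPf sx) (rt_in (rooted_up x rP)).
rewrite inE xr w1 eqxx !no_stableU; apply/and5P; split=> //.
- apply/andP; split; apply/forall_inP => z.
    by move=> /(subsetP (src_up x)); apply: good_src.
  by move/out_typeP->.
- apply/andP; split; last by move: good; rewrite no_stableU => /andP[].
  apply/forall_inP => z /(src_sub (rooted_down rP xr))[/good_src //|].
  case=> c [v []]; rewrite !inE negbK => cu vu cv zc.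
  (* [x] is the only node of its full subtree whose arrow leaves it. *)
  suff ecx : c = x by rewrite (out_typeP zc) ecx.
  apply/eqP; apply: contraNT vu => cx.
  have cu' : c \in up P x by rewrite inE.
  have [w wu cw] := rt_par (rooted_up x rP) cu' cx.
  by rewrite inE in wu; rewrite (rfun cv cw).
- by move: wt2; rewrite (wt_setC (up P x)) w1; lia.
Qed.

(** By [wt_up] these are the roots of the full subtrees of weight 2 that merge to an interior edge:
    at [r] the weight is already 2 and the target must be of type [o]; elsewhere a stable target
    supplies the second unit. *)
Definition interior_tops :=
  [set t | (x \in up P t) && ((t == r) && (sg r == TO) || (sg t == TS))].

(** The source of an interior edge has no stable vertex, so [S] contains its stable children and the
    weight formula forces [x] into [S]. All children other than [x] are stable, so [S] is a full
    subtree. *)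
Lemma interior_block t S : ((t, S, false) \in blocks P r) =
  (S == up P t) && (t \in interior_tops).
Proof.
rewrite [LHS]inE /= good wt2 /=; apply/and3P/andP.
  case=> /(subtreeP rP) rS /and3P[_ _ /andP[/forall_inP srcS /forall_inP tgtS]] /eqP wS.
  have clS c v : v \in S -> parr P c v -> sg c = TS -> c \in S.
    move=> vS cv sc; apply/negPn/negP => cS; have [z ez] := rbt c.
    have zc : z \in bt (plab P c) by rewrite ez set11.
    have := srcS z; rewrite (out_typeP zc) sc => /(_ _)/eqP[] //.
    by apply/bigcupP; exists v => //; apply: (entry_ssrc rP rS cS vS cv zc).
  move: wS; rewrite (wt_excess rS clS) sum_excess => /eqP; rewrite eqz_nat => /eqP wS.
  (* Without [x] the weight is at most 1: a subtree containing the root has [t = r], whose target is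
     not stable. *)
  have xS : x \in S.
    move: wS; have [rS'|_] := boolP (r \in S); last by case: (x \in S); case: eqP.
    by rewrite (subtree_root rP rS rS') (negPf root_out); case: (x \in S).
  have eS : S = up P t.
    apply: (closed_up rS) => c v vS cv; have [-> // | cx] := eqVneq c x.
    have cr : c != r by apply: contraTneq cv => ->; rewrite (rt_top rP).
    by apply: clS vS cv _; have [] := ordinary cr cx.
  have rS' : (r \in S) = (t == r) by rewrite eS r_up.
  split; first exact/eqP.
  rewrite rS' xS in wS; rewrite inE -eS xS /=.
  have [tr | ntr] := eqVneq t r; last first.
    by move: wS; rewrite (negPf ntr); case: (sg t == TS).
  rewrite tr (negPf root_out) orbF /=; have [z ez] := rbt r.
  have /tgtS : z \in bt (merged P S t false) by rewrite [bt _]/= tr ez set11.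
  rewrite (@out_typeP r) ?ez ?set11 //.
  by move: root_out; case: (sg r); rewrite ?eqxx ?vtype_eqE.
case=> /eqP-> tI; have rU := rooted_up t rP.
move: tI; rewrite inE => /andP[xU tE]; split; first exact/(subtreeP rP).
  rewrite merged_valid //; apply/andP; split.
    by apply/forall_inP => z /(subsetP (src_up t)); apply: good_src.
  apply/forall_inP => z /out_typeP->; case/orP: tE => [/andP[/eqP-> /eqP->]|/eqP->];
  by rewrite vtype_eqE.
rewrite wt_up xU; case/orP: tE => [/andP[/eqP-> /eqP->]|/eqP sS].
  by rewrite eqxx vtype_eqE.
rewrite sS; have [e|_] := eqVneq t r; last by rewrite eqxx.
by move: root_out; rewrite -e sS eqxx.
Qed.

(** Nodes other than [x] and [r] are interior, so no other pair can consist of boundary nodes. *)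
Lemma boundary_block t S : ((t, S, true) \in blocks P r) =
  [&& bmu (plab P x), bmu (plab P r), parr P x r, t == r & S == [set x; r]].
Proof.
rewrite inE good wt2 eqxx /=; apply/idP/idP.
  case/and3P=> /(subtreeP rP) rS _ /andP[/forall_inP bS /eqP cS].
  have eS : S = [set x; r].
    apply/eqP; rewrite eqEcard cS cards2 xr andbT; apply/subsetP => v vS.
    rewrite !inE; apply/orP; have [|vx] := eqVneq v x; [by left | right].
    apply/negPn/negP => vr; have [] := ordinary vr vx.
    by rewrite (bS v vS).
  have xS : x \in S by rewrite eS !inE eqxx.
  have rS' : r \in S by rewrite eS !inE eqxx orbT.
  have tr := subtree_root rP rS rS'; rewrite tr in rS *.
  rewrite !bS // eqxx eS eqxx !andbT /=.
  have [w] := rt_par rS xS xr; rewrite eS !inE => /orP[/eqP->|/eqP->] //.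
  by move=> xx; move: (rt_irr rP (inT x)); rewrite xx.
case/and5P=> bx br xr' /eqP-> /eqP->.
have bS v : v \in [set x; r] -> bmu (plab P v) by rewrite !inE => /orP[] /eqP->.
have rS : rooted P [set x; r] r.
  apply: (rt_sup rP); rewrite ?subsetT ?inE ?eqxx ?orbT // => v.
  by rewrite !inE => /orP[] /eqP->; [exists r; rewrite ?inE ?eqxx ?orbT | rewrite eqxx].
apply/and3P; split; first exact/(subtreeP rP).
  rewrite merged_valid //; apply/forall_inP => z /setUP[/bigcupP[v vS]|zr].
    case/setDP=> zv _; have /and3P[_ _] := rt_valid rP (inT v).
    by rewrite (bS v vS) => /forall_inP; apply; rewrite inE zv.
  have /and3P[_ _] := rt_valid rP (inT r).
  by rewrite br => /forall_inP; apply; rewrite inE zr orbT.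
by rewrite cards2 xr andbT; apply/forall_inP.
Qed.

Lemma card_blocks : #|blocks P r| = #|interior_tops| +
  [&& bmu (plab P x), bmu (plab P r) & parr P x r].
Proof.
set b := [&& _, _ & _].
pose B : {set N * {set N} * bool} := if b then [set (r, [set x; r], true)] else set0.
have BF y : (y, false) \in B = false.
  by rewrite /B; case: (b); rewrite ?in_set0 // in_set1 xpair_eqE andbF.
have -> : blocks P r = [set (t, up P t, false) | t in interior_tops] :|: B.
  apply/setP => -[[t S] mu]; rewrite in_setU; case: mu.
    rewrite boundary_block (_ : (_ \in imset _ _) = false) /=; last first.
      by apply/negP => /imsetP[].
    rewrite /B /b; case: (bmu (plab P x)); case: (bmu (plab P r));
    case: (parr P x r); rewrite /= ?in_set0 //.
    by rewrite in_set1 !xpair_eqE eqxx andbT.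
  rewrite interior_block BF orbF.
  apply/andP/imsetP => [[/eqP-> tI] | [u uI [-> ->]]]; first by exists t.
  by rewrite eqxx.
rewrite cardsU [X in _ - #|pred_of_set X|](_ : _ = set0) ?cards0 ?subn0.
  rewrite card_imset => [|t u [] //]; congr (_ + _).
  by rewrite /B; case: (b); rewrite ?cards1 ?cards0.
apply/eqP; rewrite -subset0; apply/subsetP => y /setIP[/imsetP[t _ ->]].
by rewrite BF.
Qed.
End ExtraNode.

Lemma parity : odd #|blocks P r| = odd #|cuts P r|.
Proof.
have [x xr excessE] := excess_nodes.
rewrite (card_blocks xr excessE) (cutsE xr excessE).
have [p _ xp] := rt_par rP (inT x) xr.
have rtop c : parr P r c = false by exact: negPf (rt_top rP (inT c)).
have topE t : t \in interior_tops x = connect (parr P) x t &&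
  ((t == r) && (sg r == TO) || (sg t == TS)) by rewrite !inE.
have step u v t : parr P u v -> connect (parr P) u t = (t == u) || connect (parr P) v t.
  move=> uv; apply/idP/orP.
    case/connectP=> -[|w q] /=; first by move=> _ ->; left.
    case/andP=> uw wq e; right; rewrite (rfun uv uw).
    by apply/connectP; exists q.
  case=> [/eqP-> // | vt]; exact: connect_trans (connect1 uv) vt.
have connr t : connect (parr P) r t = (t == r).
  apply/connectP/eqP => [[[|w q] /=]|->]; [by [] | by rewrite rtop | by exists [::]].
have srE : sg r = if bmu (plab P r) then TU else TO.
  move: root_out; case: (boolP (bmu _)) => [/boundary_out|/interior_out].
    by case: (sg r); rewrite ?eqxx.
  by case: (sg r); rewrite ?eqxx.
have [epr | npr] := eqVneq p r.
  rewrite epr in xp; rewrite xp andbT.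
  have connE t : t \in interior_tops x = ((t == x) || (t == r)) &&
    ((t == r) && (sg r == TO) || (sg t == TS)).
    by rewrite topE (step x r) // connr.
  case: (boolP (bmu (plab P r))) srE => br srE; last first.
    (* Interior root: its target has type [o], so the only contraction is that of [P] itself,
       matched by the single cut at [x]. *)
    have sx : sg x != TS by apply: contra br => /eqP; apply: stable_arrow xp.
    rewrite (negPf sx) andbF addn0 cards1 (_ : interior_tops x = [set r]) ?cards1 //.
    apply/setP => t; rewrite connE inE srE eqxx andbT.
    have [->|tr] := eqVneq t r; first by rewrite orbT.
    by have [->|] := eqVneq t x; rewrite //= (negPf sx).
  have sx : sg x != TO.
    by apply: contraTneq br => sx; apply: (interior_arrow xp sx).
  have bx : bmu (plab P x).
    have := excessE x; rewrite (negPf xr) eqxx /excess (negPf sx).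
    by case: (bmu _).
  have [sxS | sxS] := eqVneq (sg x) TS.
    (* Stable arrow from [x] to a boundary root: the interior contraction at [x] and the boundary
       pair cancel, and there is no cut. *)
    rewrite bx cards0 (_ : interior_tops x = [set x]) ?cards1 //.
    apply/setP => t; rewrite connE inE srE vtype_eqE andbF /=.
    have [->|tx] := eqVneq t x; first by rewrite sxS eqxx.
    by have [->|] := eqVneq t r; rewrite //= srE vtype_eqE.
  (* Unstable arrow: the boundary pair is matched by the cut at [x]. *)
  rewrite bx cards1 (_ : interior_tops x = set0) ?cards0 //.
  apply/setP => t; rewrite connE inE srE vtype_eqE andbF /=.
  have [->|tx] := eqVneq t x; first by rewrite (negPf sxS).
  by have [->|] := eqVneq t r; rewrite //= srE vtype_eqE.
(* Here [p] is interior with stable target, so its parent is boundary and must be the root; the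
   contraction at [p] is matched by the cut at [x]. *)
have px : p != x by apply: contraTneq xp => ->; apply: (rt_irr rP).
have [nbp sp] := ordinary excessE npr px.
have sx : sg x != TS by apply: contra nbp => /eqP; apply: stable_arrow xp.
have [q _ pq] := rt_par rP (inT p) npr.
have bq := stable_arrow pq sp.
have eqr : q = r.
  apply/eqP/negPn/negP => qr; have qx : q != x.
    by apply: contraTneq pq => ->; apply: (rt_asym rP).
  by have [] := ordinary excessE qr qx; rewrite bq.
subst q; rewrite bq in srE.
have nxr : parr P x r = false.
  by apply: contraNF npr => /(rfun xp) ->.
rewrite nxr !andbF addn0 (negPf sx) cards1 (_ : interior_tops x = [set p]) ?cards1 //.
apply/setP => t; rewrite topE (step x p) // (step p r) // connr inE srE vtype_eqE andbF /=.
have [-> | tp] := eqVneq t p; first by rewrite orbT sp eqxx.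
have [-> | tx] := eqVneq t x; first by rewrite (negPf sx).
by have [->|] := eqVneq t r; rewrite //= srE vtype_eqE.
Qed.
End Parity.
End Paths.

Theorem theorem4p11 (V : finType) (E : {set {set V} * {set V}}) :
  higraph E -> tree_like E ->
  forall (n : nat) (rho : CP V n), is_path (cp2p rho) E ->
  coef_dD E rho = coef_DD E rho.
Proof.
move=> [transE _] treeE n rho /(path_rooted treeE)[r rP].
rewrite (coef_dD_blocks treeE transE rP) (coef_DD_cuts treeE transE rP).
have [/andP[good /eqP wt2] | bad] :=
  boolP (no_stable (src (cp2p rho) setT :|: bt (plab (cp2p rho) r))
         && (wt (cp2p rho) setT == 2%R)).
  exact: (parity treeE transE rP good wt2).
have -> : cuts (cp2p rho) r = set0.
  apply/eqP; rewrite -subset0; apply/subsetP => a.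
  by case/(cuts_good rP) => good wt2; rewrite good wt2 eqxx in bad.
suff -> : blocks E (cp2p rho) r = set0 by rewrite !cards0.
apply/eqP; rewrite -subset0; apply/subsetP => -[[t T] mu].
by rewrite inE => /and5P[_ good wt2 _ _]; rewrite good wt2 in bad.
Qed.
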